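(* Let $k\ge1$ be an integer, $c\in\mathbb{C}$ a constant and $\alpha\in\mathbb{R}$ with $|\alpha|\ge1$. For all $f\in L^2(\mathbb{C},e^{-|z|^2})$ there exists a weak solution $u\in L^2(\mathbb{C},e^{-|z|^2})$ of the equation $$\alpha\,\partial^k\bar\partial^k u+cu=\alpha f$$ with $$\int_{\mathbb{C}}|u|^2e^{-|z|^2}\,d\sigma\le\frac{|\alpha|^2}{(k!)^2}\int_{\mathbb{C}}|f|^2e^{-|z|^2}\,d\sigma .$$
   Context: $\partial=\partial/\partial z$, $\bar\partial=\partial/\partial\bar z$, $\partial^k,\bar\partial^k$ are their $k$-th iterates, and $d\sigma$ is Lebesgue measure on $\mathbb{C}$. $L^2(\mathbb{C},e^{-|z|^2})$ is the space of $f\in L^2_{loc}(\mathbb{C})$ with $\int_{\mathbb{C}}|f|^2e^{-|z|^2}d\sigma<\infty$. A function $u\in L^2_{loc}(\mathbb{C})$ is a weak solution of $\alpha\partial^k\bar\partial^ku+cu=g$ if $\int_{\mathbb{C}}u\,\big(\alpha\,\partial^k\bar\partial^k\phi+c\,\phi\big)d\sigma=\int_{\mathbb{C}}g\phi\,d\sigma$ for all smooth compactly supported $\phi:\mathbb{C}\to\mathbb{C}$. *)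

(* Defs.v *)
From HB Require Import structures.
From mathcomp Require Import all_boot all_order all_algebra.
From mathcomp Require Import all_classical all_reals all_analysis.
From mathcomp Require Import complex.

Set Implicit Arguments.
Unset Strict Implicit.
Unset Printing Implicit Defensive.

Import Order.TTheory GRing.Theory Num.Theory.
Import numFieldNormedType.Exports.

Local Open Scope classical_set_scope.
Local Open Scope ring_scope.
Local Open Scope complex_scope.

Definition toC (R : realType) (p : R * R) : R[i] := p.1 +i* p.2.

(* R[i] has neither a measure nor a real normed-module structure in the
   libraries, so the measure, the topology and the real partial derivatives on
   the complex plane are those of R * R, transported along toC. *)
Definition rpart (R : realType) (g : R[i] -> R[i]) (p : R * R) : R :=
  complex.Re (g (toC p)).
Definition ipart (R : realType) (g : R[i] -> R[i]) (p : R * R) : R :=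
  complex.Im (g (toC p)).

(* The modulus as an element of R; `|z| is an element of R[i]. *)
Definition modulus (R : realType) (z : R[i]) : R := ComplexField.Normc.normc z.

Notation plane_measure R :=
  (@lebesgue_measure R \x @lebesgue_measure R)%E.

Definition cintegral (R : realType) (g : R[i] -> R[i]) : R[i] :=
  Rintegral (plane_measure R) setT (rpart g)
  +i* Rintegral (plane_measure R) setT (ipart g).

Definition cmeasurable (R : realType) (g : R[i] -> R[i]) : Prop :=
  measurable_fun setT (rpart g) /\ measurable_fun setT (ipart g).

Definition L2loc (R : realType) (g : R[i] -> R[i]) : Prop :=
  cmeasurable g /\
  forall K : set (R * R), compact K ->
    (\int[plane_measure R]_(p in K) (modulus (g (toC p)) ^+ 2)%:E < +oo)%E.

Definition gauss_sqnorm (R : realType) (g : R[i] -> R[i]) : \bar R :=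
  (\int[plane_measure R]_p
     (modulus (g (toC p)) ^+ 2 * expR (- modulus (toC p) ^+ 2))%:E)%E.

Definition L2gauss (R : realType) (g : R[i] -> R[i]) : Prop :=
  L2loc g /\ (gauss_sqnorm g < +oo)%E.

Fixpoint Ck (R : realType) (n : nat) (g : R * R -> R) : Prop :=
  continuous g /\
  match n with
  | 0 => True
  | m.+1 =>
      [/\ forall p, derivable g p (1, 0), forall p, derivable g p (0, 1),
          Ck m (fun p => 'D_(1, 0) g p) & Ck m (fun p => 'D_(0, 1) g p)]
  end.

Definition csmooth (R : realType) (g : R[i] -> R[i]) : Prop :=
  forall n, Ck n (rpart g) /\ Ck n (ipart g).

Definition compactly_supported (R : realType) (g : R[i] -> R[i]) : Prop :=
  compact (closure [set p : R * R | g (toC p) != 0]).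

Definition partial_along (R : realType) (v : R * R) (g : R[i] -> R[i])
    (z : R[i]) : R[i] :=
  let p := (complex.Re z, complex.Im z) in
  'D_v (rpart g) p +i* 'D_v (ipart g) p.

Definition wirtinger (R : realType) (g : R[i] -> R[i]) (z : R[i]) : R[i] :=
  2^-1 * (partial_along (1, 0) g z - 'i%C * partial_along (0, 1) g z).

Definition wirtinger_bar (R : realType) (g : R[i] -> R[i]) (z : R[i]) : R[i] :=
  2^-1 * (partial_along (1, 0) g z + 'i%C * partial_along (0, 1) g z).

Definition weak_solution (R : realType) (alpha : R) (k : nat) (c : R[i])
    (g u : R[i] -> R[i]) : Prop :=
  L2loc u /\
  forall phi : R[i] -> R[i], csmooth phi -> compactly_supported phi ->
    cintegral (fun z =>
      u z * (alpha%:C * iter k (@wirtinger R) (iter k (@wirtinger_bar R) phi) z + c * phi z)) =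
    cintegral (fun z => g z * phi z).

(* Main.v *)
(* With respect to the weight [exp |z|^2], the operators [Dz = d/dz] and
   [Dzb = d/dzbar] on test functions are commuting creation operators: their
   adjoints [a = - (Dzb + z)] and [b = - (Dz + conj z)] satisfy
   [a Dz = Dz a + 1] and [b Dzb = Dzb b + 1].  Normal ordering gives
   [|Dz^k u|^2 = sum_j C(k,j)^2 (k-j)! |a^j u|^2], hence
   [|Dz^k Dzb^k u|^2 >= k!^2 |u|^2 + |b^k a^k u|^2]; since [b^k a^k] is the
   adjoint of [Dz^k Dzb^k] and commutes with constants, this yields
   [|(Dz^k Dzb^k + c) u| >= k! |u|] for every complex [c].  The weak solution is
   then the Riesz representative, in the closure of the range of
   [Dz^k Dzb^k + c], of the functional [u |-> Re (integral of f u)]; it is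
   obtained as the limit of a fast minimising sequence, which converges almost
   everywhere. *)
From HB Require Import structures.
Require Import Defs.
From mathcomp Require Import all_boot all_order all_algebra.
From mathcomp Require Import all_classical all_reals all_analysis measurable_realfun.
From mathcomp Require Import complex ring lra zify.

Set Implicit Arguments.
Unset Strict Implicit.
Unset Printing Implicit Defensive.

Import Order.TTheory GRing.Theory Num.Theory.
Import numFieldNormedType.Exports.

Local Open Scope classical_set_scope.
Local Open Scope ring_scope.
Local Open Scope complex_scope.

(** * Ladder operators *)

(** The weight [exp |z|^2] on test functions is dual to [exp (- |z|^2)]: Cauchy-Schwarz bounds the
    integral of [f phi] by the product of the two weighted norms. Compact support keeps integrals
    against this growing weight finite and removes boundary terms. Multiplication by
    [exp (|z|^2 / 2)] carries test functions isometrically into plain L2 of the plane, where the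
    limit is taken. Complex functions are pairs of real ones with a real inner product, so duality
    yields only the real part of the weak equation. The operator is complex linear, and testing
    against [- i phi] gives the imaginary part. The factor [alpha] is divided out, which replaces
    [c] by [c / alpha]. The lower bound is uniform in that constant, hence the squared norm of the
    solution is at most that of [f] over [k!^2], and [|alpha| >= 1] gives the stated bound. The
    minimum of the quadratic functional need not be attained on test functions. Almost-minimisers
    with error [16^-n] have images whose squares share one integrable majorant, so dominated
    convergence gives both the equation and the bound. *)

(* The coefficient of [ad^j a^j] in the normal ordering of [a^k ad^k]. *)
Definition ladder (k j : nat) : nat := ('C(k, j) ^ 2 * (k - j)`!)%N.

Lemma ladder0 k : ladder k 0 = k`!.
Proof. by rewrite /ladder bin0 mul1n subn0. Qed.

Lemma ladder_diag k : ladder k k = 1%N.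
Proof. by rewrite /ladder binn subnn. Qed.

Lemma ladder_gt k j : (k < j)%N -> ladder k j = 0%N.
Proof. by move=> kj; rewrite /ladder bin_small. Qed.

Lemma ladderS0 k : ladder k.+1 0 = (ladder k 0 + ladder k 1)%N.
Proof.
rewrite !ladder0 /ladder bin1; case: k => [|k]//.
by rewrite subSS subn0 !factS -mulnn -mulnA -[in RHS]mulSn.
Qed.

(** This is the recurrence obtained by applying [sqnorm_ann_cre] to each term of the expansion for
    [k] and collecting the coefficient of [|a^(j+1) u|^2]: indices [j], [j+1] and [j+2]
    contribute. *)
Lemma ladderSS k j : ladder k.+1 j.+1 =
  (ladder k j + (2 * j.+1).+1 * ladder k j.+1 + j.+2 ^ 2 * ladder k j.+2)%N.
Proof.
have [kj|jk] := ltnP k j; first by rewrite !ladder_gt ?muln0//; lia.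
have [<-|nkj] := eqVneq j k.
  by rewrite !ladder_diag !ladder_gt// !muln0.
have {jk nkj}[m ->] : exists m, k = (j + m).+1.
  by exists (k - j).-1; move/eqP: nkj; lia.
(* Over the rationals each binomial becomes a quotient of factorials, and the recurrence becomes an
   identity of rational functions in [j], [m] and three factorials. *)
pose r : nat -> rat := fun n => n%:R.
have rI : injective r by exact: (@Num.Theory.mulrIn rat 1 (oner_neq0 _)).
have r0 n : r n.+1 != 0 by rewrite /r pnatr_eq0.
have f0 n : r n`! != 0 by rewrite /r pnatr_eq0 -lt0n fact_gt0.
have binE a b : r 'C(a + b, a) = r (a + b)`! / (r a`! * r b`!).
  apply/(canRL (mulfK _)); first by rewrite mulf_neq0.
  by rewrite /r -!natrM -[in RHS](bin_fact (leq_addr b a)) addKn.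
(* The case [k = j + 1] is separate because ['C(k, j.+2)] vanishes there and has no factorial
   quotient. *)
apply: rI; rewrite /ladder; case: m => [|m].
  rewrite addn0 !binSn binn (@bin_small j.+1 j.+2)//.
  have -> : (j.+2 - j.+1 = 1)%N by lia.
  have -> : (j.+1 - j = 1)%N by lia.
  by rewrite subnn -!mulnn; congr r; rewrite !factS fact0; nia.
have e1 : ((j + m.+1).+2 = j.+1 + m.+2)%N by lia.
have e2 : ((j + m.+1).+1 = j.+1 + m.+1)%N by lia.
have e3 : ((j + m.+1).+1 = j + m.+2)%N by lia.
have e4 : ((j + m.+1).+1 = j.+2 + m)%N by lia.
have -> : ((j + m.+1).+2 - j.+1 = m.+2)%N by lia.
have -> : ((j + m.+1).+1 - j = m.+2)%N by lia.
have -> : ((j + m.+1).+1 - j.+1 = m.+1)%N by lia.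
have -> : ((j + m.+1).+1 - j.+2 = m)%N by lia.
have rD a b : r (a + b)%N = r a + r b by rewrite /r natrD.
have rM a b : r (a * b)%N = r a * r b by rewrite /r natrM.
have E1 : r 'C((j + m.+1).+2, j.+1) =
    r (j + m.+1).+2`! / (r j.+1`! * r m.+2`!)
  by rewrite e1 binE -e1.
have E2 : r 'C((j + m.+1).+1, j) =
    r (j + m.+1).+1`! / (r j`! * r m.+2`!)
  by rewrite e3 binE -e3.
have E3 : r 'C((j + m.+1).+1, j.+1) =
    r (j + m.+1).+1`! / (r j.+1`! * r m.+1`!)
  by rewrite e2 binE -e2.
have E4 : r 'C((j + m.+1).+1, j.+2) =
    r (j + m.+1).+1`! / (r j.+2`! * r m`!)
  by rewrite e4 binE -e4.
move: E1 E2 E3 E4.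
generalize 'C((j + m.+1).+2, j.+1) 'C((j + m.+1).+1, j)
  'C((j + m.+1).+1, j.+1) 'C((j + m.+1).+1, j.+2).
move=> c1 c2 c3 c4 E1 E2 E3 E4.
rewrite -!mulnn !(rD, rM) {}E1 {}E2 {}E3 {}E4.
rewrite !factS !rM.
have rS n : r n.+1 = r n + 1 by rewrite -addn1 rD.
have := r0 j; have := r0 j.+1; have := r0 m; have := r0 m.+1.
have := f0 j; have := f0 m.
rewrite !(rS, rM, rD).
move: (r (j + m.+1)`!) (r j`!) (r m`!) (r j) (r m) => K F G x y.
move=> F1 F2 F3 F4 F5 F6; rewrite (_ : r 0%N = 0)//.
by field; rewrite F1 F2 F3 F4 F5 F6.
Qed.

Section ladder_estimate.
Variables (R : realFieldType) (V : lmodType R) (B : V -> V -> R).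
Hypothesis BC : forall u v, B u v = B v u.
Hypothesis BD : forall u v w, B (u + v) w = B u w + B v w.
Hypothesis BZ : forall (t : R) u w, B (t *: u) w = t * B u w.
Hypothesis B0 : forall u, 0 <= B u u.

Let BDr u v w : B w (u + v) = B w u + B w v.
Proof. by rewrite BC BD !(BC w). Qed.
Let BZr (t : R) u w : B w (t *: u) = t * B w u.
Proof. by rewrite BC BZ (BC w). Qed.

(** * Normal ordering for one creation-annihilation pair *)

Section one_pair.
Variables (a ad : {linear V -> V}).
Hypothesis adj : forall u v, B (a u) v = B u (ad v).
Hypothesis ccr : forall u, a (ad u) = ad (a u) + u.

(** Moving [ad] to the left past each of the [j+1] factors [a] leaves one copy of [a^j] by the
    commutation relation. *)
Lemma iter_ann_cre j u :
  iter j.+1 a (ad u) = ad (iter j.+1 a u) + j.+1%:R *: iter j a u.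
Proof.
elim: j => [|j IH]; first by rewrite /= ccr scale1r.
rewrite iterS IH linearD ccr linearZ /= -addrA; congr (_ + _).
by rewrite -[X in X + _]scale1r -scalerDl addrC natr1.
Qed.

Lemma sqnorm_cre u : B (ad u) (ad u) = B (a u) (a u) + B u u.
Proof. by rewrite -adj ccr BD [B (ad _) _]BC -adj. Qed.

(** With [x = a^j u] the vector is [ad (a x) + (j+1) x]. The cross term is [2 (j+1) |a x|^2], and
    [|ad (a x)|^2] adds one more [|a x|^2], whence the coefficient [2 (j+1) + 1]. *)
Lemma sqnorm_ann_cre j u : B (iter j.+1 a (ad u)) (iter j.+1 a (ad u)) =
  B (iter j.+2 a u) (iter j.+2 a u) +
  (2 * j.+1).+1%:R * B (iter j.+1 a u) (iter j.+1 a u) +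
  j.+1%:R ^+ 2 * B (iter j a u) (iter j a u).
Proof.
rewrite iter_ann_cre; set x := iter j a u.
have -> : iter j.+2 a u = a (a x) by [].
have -> : iter j.+1 a u = a x by [].
have adj' v w : B (ad v) w = B v (a w) by rewrite BC -adj BC.
rewrite !(BD, BDr, BZ, BZr) sqnorm_cre adj' (BC x) adj' -(addn1 (2 * _)) natrD natrM.
ring.
Qed.

Lemma sqnorm_iter_cre k u : B (iter k ad u) (iter k ad u) =
  \sum_(j < k.+1) (ladder k j)%:R * B (iter j a u) (iter j a u).
Proof.
pose n j v := B (iter j a v) (iter j a v).
(* Terms beyond [k] vanish, so any [N > k] may serve as upper bound; this freedom lets the induction
   keep the same range while [k] grows. *)
suff H N : (k < N)%N -> forall v, B (iter k ad v) (iter k ad v) =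
    \sum_(j < N) (ladder k j)%:R * n j v by exact: H.
elim: k N => [|k IH] N kN v.
  case: N kN => // N _; rewrite big_ord_recl /= big1; last first.
    by move=> i _; rewrite ladder_gt ?mul0r//.
  by rewrite addr0 mul1r.
case: N kN => // N kN; rewrite iterSr (IH N.+1); last exact: ltnW.
(* The coefficient is made opaque so that distributivity does not break it apart. *)
have [c cE] : exists c : nat -> R, forall j, c j = (2 * j.+1).+1%:R.
  by exists (fun j => (2 * j.+1).+1%:R).
have nS j : n j.+1 (ad v) = n j.+2 v + c j * n j.+1 v + j.+1%:R ^+ 2 * n j v.
  by rewrite cE; exact: sqnorm_ann_cre.
have n0 : n 0 (ad v) = n 1 v + n 0 v by exact: sqnorm_cre.
have lS i : (ladder k.+1 i.+1)%:R = (ladder k i)%:R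
    + c i * (ladder k i.+1)%:R + (i.+2 ^ 2 * ladder k i.+2)%:R :> R.
  by rewrite cE ladderSS -natrM -!natrD.
rewrite big_ord_recl [RHS]big_ord_recl n0 ladderS0.
under eq_bigr => i _ do rewrite /= /bump /= add1n nS !mulrDr.
under [in RHS]eq_bigr => i _ do
  rewrite /= /bump /= add1n lS !mulrDl.
rewrite !big_split /=.
(* The three summands of [nS] shift the index up, keep it, or shift it down; [up] and [down] realign
   the two shifted sums. *)
have up : (ladder k 0)%:R * n 1 v
      + \sum_(i < N) (ladder k i.+1)%:R * n i.+2 v =
    \sum_(i < N) (ladder k i)%:R * n i.+1 v.
  have -> : \sum_(i < N) (ladder k i)%:R * n i.+1 v =
      \sum_(i < N.+1) (ladder k i)%:R * n i.+1 v.
    by rewrite big_ord_recr /= ladder_gt // mul0r addr0.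
  by rewrite big_ord_recl.
have down : \sum_(i < N) (ladder k i.+1)%:R * (i.+1%:R ^+ 2 * n i v) =
    (ladder k 1)%:R * n 0 v
    + \sum_(i < N) (i.+2 ^ 2 * ladder k i.+2)%:R * n i.+1 v.
  case: N kN {up} => // N kN; rewrite big_ord_recl [in RHS]big_ord_recr /=.
  rewrite [ladder k N.+2]ladder_gt ?muln0 ?mul0r ?addr0; last exact: ltnW.
  rewrite expr1n mul1r; congr (_ + _); apply: eq_bigr => i _.
  by rewrite /bump /= add1n natrM natrX; ring.
rewrite down -{}up natrD.
under [in RHS]eq_bigr => i _ do rewrite -mulrA mulrCA.
rewrite mulrDr mulrDl. ring.
Qed.

(** Only the terms [j = 0] and [j = k], with coefficients [k!] and 1, are kept from a sum of
    nonnegative terms; [0 < k] makes them distinct. *)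
Lemma sqnorm_iter_cre_ge k u : (0 < k)%N ->
  k`!%:R * B u u + B (iter k a u) (iter k a u) <= B (iter k ad u) (iter k ad u).
Proof.
case: k => // k _; rewrite sqnorm_iter_cre big_ord_recl big_ord_recr /=.
rewrite ladder0 /bump /= add1n ladder_diag mul1r lerD2l lerDr.
by apply: sumr_ge0 => i _; rewrite mulr_ge0.
Qed.

Lemma adj_iter k u v : B (iter k ad u) v = B u (iter k a v).
Proof.
elim: k v => // k IH v.
by rewrite iterS BC -adj BC IH -iterSr.
Qed.

End one_pair.

Variables (a ad b bd C Cd : {linear V -> V}) (k : nat).
Hypothesis adja : forall u v, B (a u) v = B u (ad v).
Hypothesis ccra : forall u, a (ad u) = ad (a u) + u.
Hypothesis adjb : forall u v, B (b u) v = B u (bd v).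
Hypothesis ccrb : forall u, b (bd u) = bd (b u) + u.
Hypothesis abdC : forall u, a (bd u) = bd (a u).
Hypothesis adjC : forall u v, B (C u) v = B u (Cd v).
Hypothesis normC : forall u, B (C u) (C u) = B (Cd u) (Cd u).
Hypothesis aC : forall u, a (C u) = C (a u).
Hypothesis bC : forall u, b (C u) = C (b u).
Hypothesis k0 : (0 < k)%N.

Let iter_comm (f g : V -> V) m n u : (forall u, f (g u) = g (f u)) ->
  iter m f (iter n g u) = iter n g (iter m f u).
Proof.
move=> fg; elim: m u => // m IH u; rewrite iterSr [in RHS]iterSr -IH.
congr (iter m f _); elim: n {IH} u => // n IH u.
by rewrite !iterS fg IH.
Qed.

(* With [T = ad^k bd^k], the difference [|T u|^2 - |T* u|^2] does not see the
   perturbation by [C], because [C] commutes with [T*]. *)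
Lemma ladder_lower_bound u (v := iter k ad (iter k bd u) + C u) :
  (k`!%:R) ^+ 2 * B u u <= B v v.
Proof.
pose T w := iter k ad (iter k bd w); pose T' w := iter k b (iter k a w).
have adjT w : B (T u) w = B u (T' w).
  by rewrite /T (adj_iter adja) (adj_iter adjb).
(* The one-pair bound is used for [a] on [bd^k u], where [a^k] passes through [bd^k], and then for
   [b] on both [u] and [a^k u]; the mixed terms are nonnegative and dropped. *)
have TT' : (k`!%:R) ^+ 2 * B u u + B (T' u) (T' u) <= B (T u) (T u).
  apply: le_trans (sqnorm_iter_cre_ge adja ccra _ k0).
  rewrite expr2 -mulrA (iter_comm k k _ abdC).
  have h1 := sqnorm_iter_cre_ge adjb ccrb u k0.
  have h2 := sqnorm_iter_cre_ge adjb ccrb (iter k a u) k0.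
  have h3 : 0 <= k`!%:R * B (iter k b u) (iter k b u) by rewrite mulr_ge0.
  have h4 : 0 <= k`!%:R * B (iter k a u) (iter k a u) by rewrite mulr_ge0.
  have h5 : k`!%:R * (k`!%:R * B u u + B (iter k b u) (iter k b u)) <=
      k`!%:R * B (iter k bd u) (iter k bd u) by rewrite ler_wpM2l.
  rewrite /T'; lra.
have cross : B (T u) (C u) = B (T' u) (Cd u).
  rewrite adjT -adjC BC; congr (B _ u); rewrite /T'.
  by rewrite (iter_comm k 1 _ aC) (iter_comm k 1 _ bC).
(* Expanding [|T u + C u|^2] and using [cross] and [normC], what exceeds [k!^2 |u|^2] is at least
   this square. *)
have : 0 <= B (T' u + Cd u) (T' u + Cd u) by [].
rewrite /v -/(T u) !(BD, BDr) (BC (C u) (T u)) (BC (Cd u)) cross normC.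
lra.
Qed.

End ladder_estimate.

(** * Minimising sequences *)

Section minimizing_sequence.
Variables (R : realType) (V : lmodType R) (B : V -> V -> R) (l : V -> R) (c : R).
Hypothesis BC : forall u v, B u v = B v u.
Hypothesis BD : forall u v w, B (u + v) w = B u w + B v w.
Hypothesis BZ : forall (t : R) u w, B (t *: u) w = t * B u w.
Hypothesis B0 : forall u, 0 <= B u u.
Hypothesis lD : forall u v, l (u + v) = l u + l v.
Hypothesis lZ : forall (t : R) u, l (t *: u) = t * l u.
Hypothesis c0 : 0 <= c.
Hypothesis lB : forall u, l u ^+ 2 <= c ^+ 2 * B u u.

(** A minimiser of this functional would represent [l] with respect to [B]. *)
Let J u := B u u - 2 * l u.

Let BDr u v w : B w (u + v) = B w u + B w v.
Proof. by rewrite BC BD !(BC w). Qed.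
Let BZr (t : R) u w : B w (t *: u) = t * B w u.
Proof. by rewrite BC BZ (BC w). Qed.

(** The polynomial is evaluated at its minimum [t = - r / q]. If [q = 0] it is affine in [t], and a
    nonzero [r] would let it take the value -1. *)
Lemma quadratic_ge0_disc (p q r : R) : 0 <= q ->
  (forall t, 0 <= p + 2 * t * r + t ^+ 2 * q) -> r ^+ 2 <= p * q.
Proof.
move=> q0 H; have [q00|qn0] := eqVneq q 0.
  have [->|rn0] := eqVneq r 0; first by rewrite q00 mulr0 expr0n.
  have := H (- (p + 1) / (2 * r)); rewrite q00 mulr0 addr0.
  have -> : p + 2 * (- (p + 1) / (2 * r)) * r = -1 by field.
  by rewrite lerNr oppr0 ler10.
have q_gt0 : 0 < q by rewrite lt_neqAle eq_sym qn0.
have := H (- r / q).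
have -> : p + 2 * (- r / q) * r + (- r / q) ^+ 2 * q = (p * q - r ^+ 2) / q.
  by field.
by rewrite pmulr_lge0 ?invr_gt0// subr_ge0.
Qed.

Lemma functional_le_sqrt u : `|l u| <= c * Num.sqrt (B u u).
Proof.
rewrite -(@ler_pXn2r _ 2)// ?nnegrE ?mulr_ge0 ?sqrtr_ge0//.
by rewrite exprMn sqr_sqrtr// real_normK ?num_real.
Qed.

(** The vectors [phi n] minimise [J] up to [eta n ^+ 2]. The three conclusions are a Cauchy
    estimate, an approximate Euler equation and a norm bound. *)
Lemma minimizing_sequence (eta : nat -> R) : (forall n, 0 < eta n) ->
  exists phi : nat -> V, forall n,
    [/\ forall m, B (phi n - phi m) (phi n - phi m)
          <= 2 * (eta n ^+ 2 + eta m ^+ 2),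
        forall u, (B (phi n) u - l u) ^+ 2 <= eta n ^+ 2 * B u u &
        B (phi n) (phi n) <= (c + eta n) ^+ 2].
Proof.
move=> eta0.
have Jlb u : - c ^+ 2 <= J u.
  have := functional_le_sqrt u; have := sqr_sqrtr (B0 u).
  set s := Num.sqrt _ => sE; rewrite /J => lu.
  have := sqr_ge0 (s - c); have := ler_norm (l u); nra.
have Jinf : has_inf (range J).
  split; first by exists (J 0), 0.
  by exists (- c ^+ 2) => _ [u _ <-].
have mJ u : inf (range J) <= J u by apply: ge_inf; [case: Jinf|exists u].
have /choice [phi phiP] n : exists u, J u < inf (range J) + eta n ^+ 2.
  have [_ [u _ <-] h] := inf_adherent (exprn_gt0 2 (eta0 n)) Jinf.
  by exists u.
(* The polynomial [J (phi n + t *: u) - inf J + (eta n ^+ 2 - J (phi n) + inf J)] in [t] is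
   nonnegative; its linear coefficient is twice the defect [B (phi n) u - l u]. *)
have B2 n u : (B (phi n) u - l u) ^+ 2 <= eta n ^+ 2 * B u u.
  apply: quadratic_ge0_disc => // t.
  have := mJ (phi n + t *: u); have := phiP n.
  rewrite /J !(BD, BDr, BZ, BZr, lD, lZ) (BC u (phi n)); lra.
exists phi => n; split=> // [m|].
  (* Parallelogram identity: [J] at the midpoint equals the mean of the two values minus a quarter
     of [B] at the difference. *)
  have := mJ (2^-1 *: (phi n + phi m)); have := phiP n; have := phiP m.
  have NE (x : V) : - x = (-1) *: x by rewrite scaleN1r.
  rewrite /J !NE !(BD, BDr, BZ, BZr, lD, lZ) (BC (phi m) (phi n)).
  have -> : 2^-1 = 1 / 2 :> R by rewrite mul1r.
  lra.
(* The Euler estimate at [u = phi n] gives [s^2 <= (c + eta n) s] for the norm [s] of [phi n]. *)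
have := B2 n (phi n); have := functional_le_sqrt (phi n).
have := sqr_sqrtr (B0 (phi n)); have := sqrtr_ge0 (B (phi n) (phi n)).
set s := Num.sqrt _; move=> s0 <- ls; rewrite -exprMn => H.
have : `|s ^+ 2 - l (phi n)| <= eta n * s.
  rewrite -(@ler_pXn2r _ 2)// ?nnegrE ?mulr_ge0// ?(ltW (eta0 n))//.
  by rewrite real_normK ?num_real.
have := ler_norm (s ^+ 2 - l (phi n)); have := ler_norm (l (phi n)) => h1 h2 h3.
rewrite ler_pXn2r ?nnegrE ?addr_ge0// ?(ltW (eta0 n))//.
have : s * s <= (c + eta n) * s by rewrite -expr2; lra.
have [->|sn0] := eqVneq s 0; first by rewrite addr_ge0// (ltW (eta0 n)).
by rewrite ler_pM2r// lt_neqAle eq_sym sn0.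
Qed.

End minimizing_sequence.

(** * Limits in L2 *)

Section fast_L2_limit.

Context d (T : measurableType d) (R : realType).
Variable mu : {measure set T -> \bar R}.

(** Increments are at most [sqrt s / 2^n], so they sum to at most [2 sqrt s]; then
    [(x + y)^2 <= 2 x^2 + 2 y^2] produces the constant 8. *)
Lemma fast_cauchy_real (w : R^nat) (s : R) :
    (forall n, 4 ^+ n * (w n.+1 - w n) ^+ 2 <= s) ->
  cvgn w /\ forall n, w n ^+ 2 <= 2 * w 0 ^+ 2 + 8 * s.
Proof.
move=> ws; have s0 : 0 <= s.
  by apply: le_trans (ws 0%N); rewrite expr0 mul1r sqr_ge0.
pose g := geometric (Num.sqrt s) (2^-1 : R).
have h2 : `|2^-1| < 1 :> R by rewrite gtr0_norm ?invf_lt1 ?ltr1n.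
have dg n : `|telescope w n| <= g n.
  rewrite /g /geometric /=.
  rewrite -(@ler_pXn2r _ 2)// ?nnegrE ?mulr_ge0 ?sqrtr_ge0 ?exprn_ge0//.
  rewrite real_normK ?num_real// exprMn sqr_sqrtr// -[in leLHS](mul1r (_ ^+ 2)).
  have e4 : (4 ^+ n)^-1 = ((2^-1) ^+ n) ^+ 2 :> R.
    by rewrite (natrX R 2 2) [RHS]exprAC [in RHS]exprVn exprVn.
  rewrite -e4 ler_pdivlMr ?exprn_gt0// mulrC mul1r.
  exact: ws.
have cg : cvgn (series g) by exact: is_cvg_geometric_series.
have cd : cvgn (series (telescope w)).
  apply: normed_cvg; apply: (series_le_cvg _ _ dg cg) => // n.
  exact: le_trans (dg n).
have sE : series (telescope w) = [sequence w n - w 0%N]_n by exact: telescopeK.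
split.
  have -> : w = (fun n => series (telescope w) n + w 0%N).
    by apply/funext => n; rewrite sE /= subrK.
  by apply: is_cvgD => //; exact: is_cvg_cst.
move=> n; have wE : w n = w 0%N + series (telescope w) n.
  by rewrite sE /= addrC subrK.
have : `|series (telescope w) n| <= 2 * Num.sqrt s.
  apply: (le_trans (ler_norm_sum _ _ _)).
  apply: (@le_trans _ _ (series g n)); first exact: ler_sum.
  apply: le_trans (geometric_le_lim n (sqrtr_ge0 s) _ h2) _ => //.
  by rewrite (_ : 1 - 2^-1 = 2^-1 :> R) ?invrK 1?mulrC//; field.
rewrite -(@ler_pXn2r _ 2)// ?nnegrE ?mulr_ge0 ?sqrtr_ge0//.
rewrite real_normK ?num_real// exprMn sqr_sqrtr// wE => h.
have := sqr_ge0 (w 0%N - series (telescope w) n); lra.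
Qed.

(** The decay [16^-n] is split in two: a factor [4^n] weights the squared increments pointwise, and
    the remaining [4^-n] keeps the sum of their integrals finite. The weighted sum is therefore
    finite almost everywhere and controls the whole sequence. *)
Lemma fast_L2_limit (w : nat -> T -> R) (K : R) :
    (forall n, measurable_fun setT (w n)) ->
    mu.-integrable setT (fun x => (w 0%N x ^+ 2)%:E) ->
    (forall n, (\int[mu]_x ((w n.+1 x - w n x) ^+ 2)%:E <= (K / 16 ^+ n)%:E)%E) ->
  exists (W h : T -> R), [/\ measurable_fun setT W,
    mu.-integrable setT (EFin \o h),
    {ae mu, forall x, w n x @[n --> \oo] --> W x} &
    {ae mu, forall x n, w n x ^+ 2 <= h x}].
Proof.
move=> mw iw0 dw.
pose f n x := ((4 ^+ n * (w n.+1 x - w n x) ^+ 2)%:E : \bar R).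
have mdw n : measurable_fun setT (fun x => (w n.+1 x - w n x) ^+ 2).
  by apply: measurable_funX; exact: measurable_funB.
have mf n : measurable_fun setT (f n).
  by apply/measurable_EFinP; apply: measurable_funM => //.
have f0 n x : (0 <= f n x)%E by rewrite lee_fin mulr_ge0 ?sqr_ge0 ?exprn_ge0.
pose S x := (\sum_(0 <= n <oo) f n x)%E.
have S0 x : (0 <= S x)%E by apply: nneseries_ge0.
have mS : measurable_fun setT S.
  exact: ge0_emeasurable_sum.
have fi n : (\int[mu]_x f n x <= (geometric K (4^-1) n)%:E)%E.
  rewrite /f; under eq_integral do rewrite EFinM.
  rewrite ge0_integralZl ?lee_fin//; last 2 first.
  - exact/measurable_EFinP.
  - by move=> x _; rewrite lee_fin sqr_ge0.
  rewrite /geometric /= (_ : 4^-1 ^+ n = 4 ^+ n / 16 ^+ n); last first.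
    have -> : 16 = 4 * 4 :> R by rewrite -natrM.
    by rewrite exprMn invfM mulrA mulfV ?mul1r ?exprVn// expf_neq0.
  by rewrite [K * _]mulrCA EFinM lee_wpmul2l ?lee_fin ?exprn_ge0.
have K0 : 0 <= K.
  have := dw 0%N; rewrite expr0 divr1 -lee_fin; apply: le_trans.
  by apply: integral_ge0 => x _; rewrite lee_fin sqr_ge0.
have iS : mu.-integrable setT S.
  apply/integrableP; split=> //.
  under eq_integral do rewrite gee0_abs//.
  rewrite integral_nneseries//.
  apply: (@le_lt_trans _ _ (K / (1 - 4^-1))%:E); last exact: ltry.
  apply: lime_le.
    by apply: is_cvg_nneseries => n _ _; exact: integral_ge0.
  apply: nearW => n; apply: (@le_trans _ _ (series (geometric K (4^-1)) n)%:E).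
    by rewrite /series /= -sumEFin; apply: lee_sum => i _; exact: fi.
  by rewrite lee_fin geometric_le_lim// gtr0_norm// invf_lt1// ltr1n.
pose h x := 2 * w 0%N x ^+ 2 + 8 * fine (S x).
have good x : S x \is a fin_num -> cvgn (w ^~ x) /\ forall n, w n x ^+ 2 <= h x.
  move=> Sx; apply: fast_cauchy_real => n.
  rewrite -lee_fin fineK//; apply: le_trans (nneseries_lim_ge n.+1 _).
    by rewrite big_nat_recr//= leeDr// sume_ge0.
  by [].
have aeS : {ae mu, forall x, S x \is a fin_num}.
  by have := integrable_ae measurableT iS; apply: filterS => x; exact.
(* The upper limit is measurable on the whole space, including where the sequence diverges; [fine]
   sends infinite values to 0. *)
exists (fun x => fine (limn_esup (fun n => (w n x)%:E))), h; split.
- apply: measurableT_comp; first exact: fine_measurable.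
  by apply: measurable_fun_limn_esup => n; exact/measurable_EFinP.
- rewrite (_ : _ \o _ =
    (fun x => 2%:E * (w 0%N x ^+ 2)%:E + 8%:E * (fine (S x))%:E)%E)//.
  apply: integrableD => //; apply: integrableZl => //.
  apply: le_integrable iS => //.
    by apply/measurable_EFinP; apply: (measurableT_comp (fine_measurable _)).
  move=> x _; by have := S0 x; case: (S x) => //=; rewrite ?normr0 ?leey.
- move: aeS; apply: filterS => x /good[cw _].
  have /cvg_limn_einf_sup[_ ->] : (w n x)%:E @[n --> \oo] --> (limn (w ^~ x))%:E.
    by apply: cvg_EFin => //; exact: nearW.
  exact: cw.
- by move: aeS; apply: filterS => x /good[_].
Qed.

End fast_L2_limit.

Section square_integrable.
Context d (T : measurableType d) (R : realType).
Variable mu : {measure set T -> \bar R}.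

Definition sq_integrable (g : T -> R) : Prop :=
  measurable_fun setT g /\ mu.-integrable setT (fun x => (g x ^+ 2)%:E).

(** The product is dominated by [f^2 + g^2]. *)
Lemma sq_integrable_mul f g : sq_integrable f -> sq_integrable g ->
  mu.-integrable setT (fun x => (f x * g x)%:E).
Proof.
move=> [mf if2] [mg ig2].
apply: (le_integrable measurableT _ _ (integrableD measurableT if2 ig2)).
  by apply/measurable_EFinP; exact: measurable_funM.
move=> x _; rewrite -EFinD !abse_EFin lee_fin [leRHS]ger0_norm ?addr_ge0 ?sqr_ge0//.
rewrite ler_norml; apply/andP; split.
  by have := sqr_ge0 (f x + g x); have := sqr_ge0 (f x); have := sqr_ge0 (g x); lra.
by have := sqr_ge0 (f x - g x); have := sqr_ge0 (f x); have := sqr_ge0 (g x); lra.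
Qed.

Lemma ae_dominated_Rintegral (F : nat -> T -> R) (G h : T -> R) :
    (forall n, measurable_fun setT (F n)) -> measurable_fun setT G ->
    mu.-integrable setT (EFin \o h) ->
    {ae mu, forall x, F n x @[n --> \oo] --> G x} ->
    {ae mu, forall x n, `|F n x| <= h x} ->
  mu.-integrable setT (EFin \o G) /\
  Rintegral mu setT (F n) @[n --> \oo] --> Rintegral mu setT G.
Proof.
move=> mF mG ih FG Fh.
have [|||||iG _ cvgI] := @dominated_convergence _ _ _ mu _ measurableT
  (fun n => EFin \o F n) (EFin \o G) (EFin \o h).
- by move=> n; exact/measurable_EFinP.
- exact/measurable_EFinP.
- move: FG; apply: filterS => x Fx _.
  by apply: cvg_EFin => //; exact: nearW.
- exact: ih.
- by move: Fh; apply: filterS => x Fx n _; rewrite /= lee_fin.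
split=> //; apply: fine_cvg.
by rewrite /Rintegral fineK//; apply: integrable_fin_num.
Qed.

(** Dominated convergence applies twice, with majorant [h] for the squares and [h + g^2] for the
    products against [g]. *)
Lemma fast_L2_cvg (w : nat -> T -> R) (K : R) :
    (forall n, sq_integrable (w n)) ->
    (forall n, Rintegral mu setT (fun x => (w n.+1 x - w n x) ^+ 2) <= K / 16 ^+ n) ->
  exists W : T -> R, [/\ sq_integrable W,
    Rintegral mu setT (fun x => w n x ^+ 2) @[n --> \oo]
      --> Rintegral mu setT (fun x => W x ^+ 2) &
    forall g, sq_integrable g -> Rintegral mu setT (fun x => w n x * g x)
      @[n --> \oo] --> Rintegral mu setT (fun x => W x * g x)].
Proof.
move=> sw dw; have mw n : measurable_fun setT (w n) by case: (sw n).
have [|||W [h [mW ih wW wh]]] := @fast_L2_limit _ _ _ mu w K.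
- exact: mw.
- by case: (sw 0%N).
(* [Rintegral] is 0 on an infinite integral, so the bound transfers only once the square is known to
   be integrable, by [(x - y)^2 <= 2 (x^2 + y^2)]. *)
- move=> n; have := dw n; rewrite -lee_fin /Rintegral fineK//.
  apply: integrable_fin_num => //.
  have i2 : mu.-integrable setT
      (fun x => 2%:E * ((w n.+1 x ^+ 2)%:E + (w n x ^+ 2)%:E))%E.
    apply: integrableZl => //; apply: integrableD => //.
      by case: (sw n.+1).
    by case: (sw n).
  apply: (le_integrable measurableT _ _ i2).
    by apply/measurable_EFinP/measurable_funX; exact: measurable_funB.
  move=> x _; rewrite -EFinD -EFinM !abse_EFin lee_fin.
  rewrite [leLHS]ger0_norm ?sqr_ge0// [leRHS]ger0_norm; last first.
    by rewrite mulr_ge0// addr_ge0 ?sqr_ge0.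
  by have := sqr_ge0 (w n.+1 x + w n x); lra.
have [|||||iW cW] := @ae_dominated_Rintegral (fun n x => w n x ^+ 2)
  (fun x => W x ^+ 2) h.
- by move=> n; exact: measurable_funX.
- exact: measurable_funX.
- exact: ih.
- by move: wW; apply: filterS => x Wx; rewrite expr2; apply: cvgM.
- by move: wh; apply: filterS => x hx n; rewrite ger0_norm// sqr_ge0.
exists W; split=> // g [mg ig].
have [|||||_ //] := @ae_dominated_Rintegral (fun n x => w n x * g x)
  (fun x => W x * g x) (fun x => h x + g x ^+ 2).
- by move=> n; exact: measurable_funM.
- exact: measurable_funM.
- exact: (integrableD measurableT ih ig).
- by move: wW; apply: filterS => x Wx; apply: cvgM => //; exact: cvg_cst.
- move: wh; apply: filterS => x hx n; have := hx n; rewrite ler_norml => hn.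
  apply/andP; split.
    by have := sqr_ge0 (w n x + g x); have := sqr_ge0 (w n x);
      have := sqr_ge0 (g x); lra.
  by have := sqr_ge0 (w n x - g x); have := sqr_ge0 (w n x); have := sqr_ge0 (g x); lra.
Qed.

End square_integrable.

(** * Smooth functions on the plane *)

Section plane_borel.

Variable R : realType.

(** The measurable structure is the product one, so an open set has to be exhibited as a countable
    union of rectangles, here squares with rational centre and radius. *)
Lemma open_plane_measurable (O : set (R * R)) : open O -> measurable O.
Proof.
move=> oO.
pose box (a b r : rat) := ball (ratr a : R) (ratr r) `*` ball (ratr b : R) (ratr r).
(* Inclusion in [O] is part of the set: a box not contained in [O] contributes the empty set, and
   the union can run over all rationals. *)
pose good a b r : set (R * R) := [set p | box a b r `<=` O /\ box a b r p].
rewrite (_ : O = \bigcup_a \bigcup_b \bigcup_r good a b r).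
  apply: bigcupT_measurable_rat => a; apply: bigcupT_measurable_rat => b.
  apply: bigcupT_measurable_rat => r.
  have [sub|nsub] := pselect (box a b r `<=` O); last first.
    by rewrite (_ : good _ _ _ = set0)//; apply/seteqP; split=> // p [].
  rewrite (_ : good _ _ _ = box a b r); last first.
    by apply/seteqP; split=> [p []|p ?]//; split.
  by apply: measurableX; exact: measurable_ball.
apply/seteqP; split=> [[x y] Oxy|p [a _ [b _ [r _ [sub]]]]]; last exact: sub.
have /nbhs_ballP[e /= e0 eO] : nbhs (x, y) O by exact: open_nbhs_nbhs.
have close (z : R) : exists a : rat, `|z - ratr a| < e / 4.
  have [|a] := @rat_in_itvoo _ (z - e / 4) (z + e / 4); first by lra.
  rewrite in_itv /= => /andP[h1 h2]; exists a.
  by rewrite ltr_norml; apply/andP; split; lra.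
have [a xa] := close x; have [b yb] := close y.
(* A radius above [e / 4] captures the point, and one below [e / 2] keeps the box within distance
   [3 e / 4] of it. *)
have [|r] := @rat_in_itvoo _ (e / 4) (e / 2); first by lra.
rewrite in_itv /= => /andP[r1 r2].
exists a => //; exists b => //; exists r => //; split; last first.
  by split; rewrite /ball /= distrC; [apply: lt_trans xa _|apply: lt_trans yb _].
move=> [x' y'] [/= h1 h2]; apply: eO; split=> /=.
- rewrite /ball /= (_ : x - x' = (x - ratr a) + (ratr a - x')); last by ring.
  by apply: le_lt_trans (ler_normD _ _) _; move: h1; rewrite /ball /=; lra.
- rewrite /ball /= (_ : y - y' = (y - ratr b) + (ratr b - y')); last by ring.
  by apply: le_lt_trans (ler_normD _ _) _; move: h2; rewrite /ball /=; lra.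
Qed.

Lemma continuous_plane_measurable (g : R * R -> R) :
  continuous g -> measurable_fun setT g.
Proof.
move=> /continuousP cg; apply: (measurability _ (RGenOpens.measurableE R)).
move=> _ [_ [a [b ->] <-]]; rewrite setTI.
by apply: open_plane_measurable; exact/cg/interval_open.
Qed.

Lemma compact_plane_measurable (K : set (R * R)) : compact K -> measurable K.
Proof.
move=> cK; rewrite -(setCK K); apply: measurableC; apply: open_plane_measurable.
by apply/closed_openC/(compact_closed _ cK); exact: (@norm_hausdorff R (R * R)%type).
Qed.

End plane_borel.

Section smooth_functions.
Variable R : realType.
Implicit Types (f g : R * R -> R) (p v : R * R).

Lemma Ck_continuous n g : Ck n g -> continuous g.
Proof. by case: n => [|n] []. Qed.

Lemma CkS n g : Ck n.+1 g -> Ck n g.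
Proof.
elim: n g => [|n IH] g; first by case.
move=> [cg [d1 d2 c1 c2]]; split; first exact cg.
split; [exact d1|exact d2|exact (IH _ c1)|exact (IH _ c2)].
Qed.

Lemma Ck_cst n (r : R) : Ck n (fun=> r).
Proof.
elim: n r => [|n IH] r; first by split=> // p; exact: cvg_cst.
have D0 v : (fun p => 'D_v (fun=> r) p) = fun=> 0.
  by apply/funext => p; exact: derive_cst.
split; first by move=> p; exact: cvg_cst.
by split=> [p|p||]; [exact: derivable_cst|exact: derivable_cst| |];
  rewrite D0; exact (IH 0).
Qed.

Lemma CkD n f g : Ck n f -> Ck n g -> Ck n (fun p => f p + g p).
Proof.
elim: n f g => [|n IH] f g [cf sf] [cg sg].
  by split=> // p; apply: cvgD; [exact: cf|exact: cg].
split; first by move=> p; apply: cvgD; [exact: cf|exact: cg].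
case: sf sg => f1 f2 cf1 cf2 [g1 g2 cg1 cg2].
have DD v : (forall p, derivable f p v) -> (forall p, derivable g p v) ->
    (fun p => 'D_v (fun p => f p + g p) p) = fun p => 'D_v f p + 'D_v g p.
  by move=> fv gv; apply/funext => p; exact: deriveD.
split=> [p|p||]; [exact: derivableD|exact: derivableD| |].
- rewrite DD; [exact (IH _ _ cf1 cg1)|exact f1|exact g1].
- rewrite DD; [exact (IH _ _ cf2 cg2)|exact f2|exact g2].
Qed.

Lemma CkM n f g : Ck n f -> Ck n g -> Ck n (fun p => f p * g p).
Proof.
elim: n f g => [|n IH] f g.
  by move=> [cf sf] [cg sg]; split=> // p; apply: cvgM; [exact: cf|exact: cg].
move=> Cf Cg; have Cf' := CkS Cf; have Cg' := CkS Cg.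
case: Cf Cg => cf [f1 f2 cf1 cf2] [cg [g1 g2 cg1 cg2]].
split; first by move=> p; apply: cvgM; [exact: cf|exact: cg].
have DM v : (forall p, derivable f p v) -> (forall p, derivable g p v) ->
    (fun p => 'D_v (fun p => f p * g p) p)
      = fun p => f p * 'D_v g p + g p * 'D_v f p.
  by move=> fv gv; apply/funext => p; exact: deriveM.
split=> [p|p||]; [exact: derivableM|exact: derivableM| |].
- rewrite DM; [|exact f1|exact g1].
  exact (CkD (IH _ _ Cf' cg1) (IH _ _ Cg' cf1)).
- rewrite DM; [|exact f2|exact g2].
  exact (CkD (IH _ _ Cf' cg2) (IH _ _ Cg' cf2)).
Qed.

Lemma CkZ n (r : R) g : Ck n g -> Ck n (fun p => r * g p).
Proof. by move=> Cg; exact (CkM (Ck_cst n r) Cg). Qed.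

(** The difference quotients in direction [(1, 0)] are exactly those of the slice, so existence and
    value of the derivative transfer together. *)
Let slope1E g p : (fun h : R => h^-1 *: ((g \o shift p) (h *: (1, 0)) - g p)) =
  fun h => h^-1 *: (((fun t => g (t, p.2)) \o shift p.1) (h *: 1) - g (p.1, p.2)).
Proof.
apply/funext => h /=; case: p => x y /=.
rewrite /GRing.scale /= /scale_pair /= /GRing.scale /= /GRing.add /= /add_pair /=.
by rewrite mulr0 add0r.
Qed.

Lemma derive_slice1 g p : 'D_(1, 0) g p = 'D_1 (fun t => g (t, p.2)) p.1.
Proof. by rewrite /derive slope1E. Qed.

Lemma derivable_slice1 g p :
  derivable g p (1, 0) <-> derivable (fun t => g (t, p.2)) p.1 1.
Proof. by rewrite /derivable slope1E. Qed.

Let slope2E g p : (fun h : R => h^-1 *: ((g \o shift p) (h *: (0, 1)) - g p)) =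
  fun h => h^-1 *: (((fun t => g (p.1, t)) \o shift p.2) (h *: 1) - g (p.1, p.2)).
Proof.
apply/funext => h /=; case: p => x y /=.
rewrite /GRing.scale /= /scale_pair /= /GRing.scale /= /GRing.add /= /add_pair /=.
by rewrite mulr0 add0r.
Qed.

Lemma derive_slice2 g p : 'D_(0, 1) g p = 'D_1 (fun t => g (p.1, t)) p.2.
Proof. by rewrite /derive slope2E. Qed.

Lemma derivable_slice2 g p :
  derivable g p (0, 1) <-> derivable (fun t => g (p.1, t)) p.2 1.
Proof. by rewrite /derivable slope2E. Qed.

Lemma Ck_fst n : Ck n (fun p : R * R => p.1).
Proof.
case: n => [|n]; first by split=> // p; exact: cvg_fst.
split; first by move=> p; exact: cvg_fst.
have D1 : (fun p : R * R => 'D_(1, 0) (fun p => p.1) p) = fun=> 1 : R.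
  by apply/funext => p; rewrite derive_slice1 derive_id.
have D2 : (fun p : R * R => 'D_(0, 1) (fun p => p.1) p) = fun=> 0 : R.
  by apply/funext => p; rewrite derive_slice2 derive_cst.
split=> [p|p||].
- by apply/derivable_slice1; exact: derivable_id.
- by apply/derivable_slice2; exact: derivable_cst.
- by rewrite D1; exact (Ck_cst n _).
- by rewrite D2; exact (Ck_cst n _).
Qed.

Lemma Ck_snd n : Ck n (fun p : R * R => p.2).
Proof.
case: n => [|n]; first by split=> // p; exact: cvg_snd.
split; first by move=> p; exact: cvg_snd.
have D1 : (fun p : R * R => 'D_(1, 0) (fun p => p.2) p) = fun=> 0 : R.
  by apply/funext => p; rewrite derive_slice1 derive_cst.
have D2 : (fun p : R * R => 'D_(0, 1) (fun p => p.2) p) = fun=> 1 : R.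
  by apply/funext => p; rewrite derive_slice2 derive_id.
split=> [p|p||].
- by apply/derivable_slice1; exact: derivable_cst.
- by apply/derivable_slice2; exact: derivable_id.
- by rewrite D1; exact (Ck_cst n _).
- by rewrite D2; exact (Ck_cst n _).
Qed.

End smooth_functions.

(** * Integrals of functions with bounded support *)

Section bounded_support.
Variable R : realType.
Implicit Types (f g : R * R -> R) (p v : R * R).
Local Notation mu := (plane_measure R).

(** A radius bound is used in place of a compact closure because it passes directly to derivatives,
    sums and slices. *)
Definition bounded_support g := exists M : R, forall p, M < `|p| -> g p = 0.

Lemma norm_gt_nbhs (M : R) (V : normedModType R) (x : V) :
  M < `|x| -> \forall y \near x, M < `|y|.
Proof. exact: (@cvgr_norm_gt _ _ _ (nbhs x) _ id x). Qed.

Lemma derive_outside (V : normedModType R) (g : V -> R) (M : R) (x v : V) :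
  (forall y, M < `|y| -> g y = 0) -> M < `|x| -> 'D_v g x = 0.
Proof.
move=> g0 Mx; rewrite (near_eq_derive (g := fun=> 0)) ?derive_cst//.
by apply: filterS (norm_gt_nbhs Mx) => y; exact: g0.
Qed.

Lemma bounded_support_integrable g : continuous g -> bounded_support g ->
  mu.-integrable setT (EFin \o g).
Proof.
move=> cg [M gM].
pose I : set R := `[- `|M|, `|M|]%classic; pose K := I `*` I.
have cK : compact K by apply: compact_setX; exact: segment_compact.
have gK p : ~ K p -> g p = 0.
  move=> nK; apply: gM; apply: le_lt_trans (ler_norm M) _.
  rewrite ltNge; apply/negP; rewrite prod_normE ge_max => /andP[p1 p2].
  by apply: nK; split; rewrite /I /= in_itv /= -ler_norml.
rewrite (_ : EFin \o g = (EFin \o g) \_ K); last first.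
  apply/funext => p; rewrite patchE; case: ifPn => //.
  by rewrite notin_setE => /gK /= ->.
have mK := compact_plane_measurable cK.
apply: (iffLR (@integrable_mkcond _ _ _ mu _ (EFin \o g) mK)).
apply: measurable_bounded_integrable.
- exact: (compact_plane_measurable cK).
- suff H : (lebesgue_measure I * lebesgue_measure I < +oo)%E.
    by move: H; rewrite -product_measure1E//; exact: measurable_itv.
  rewrite lebesgue_measure_itv /=.
  by case: ifPn => _; rewrite ?mule0 ?ltry// -EFinB -EFinM ltry.
- apply: measurable_funTS; exact: continuous_plane_measurable.
- have := continuous_compact (continuous_subspaceT cg) cK.
  move=> /compact_bounded [N [Nr NP]]; exists N; split=> // x Nx p Kp.
  by apply: (NP x Nx); exists p.
Qed.

Lemma continuous_slice1 g (y : R) : continuous g -> continuous (fun x => g (x, y)).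
Proof.
move=> cg x; apply: (@continuous_comp _ _ _ (fun x => (x, y)) g); last exact: cg.
exact: (@cvg_pair _ _ _ (nbhs x) (nbhs x) (nbhs y) _ _ _ id (fun=> y)
  cvg_id (cvg_cst y)).
Qed.

Lemma continuous_slice2 g (x : R) : continuous g -> continuous (fun y => g (x, y)).
Proof.
move=> cg y; apply: (@continuous_comp _ _ _ (fun y => (x, y)) g); last exact: cg.
exact: (@cvg_pair _ _ _ (nbhs y) (nbhs x) (nbhs y) _ _ _ (fun=> x) id
  (cvg_cst x) cvg_id).
Qed.

Lemma integral_derive_bounded_support (F : R -> R) (M : R) :
    continuous (fun x => 'D_1 F x) -> (forall x, derivable F x 1) ->
    (forall x, M < `|x| -> F x = 0) ->
  (\int[lebesgue_measure]_x ('D_1 F x)%:E = 0)%E.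
Proof.
(* [N] strictly exceeds [M], so [F] vanishes at both endpoints and its derivative vanishes outside
   the interval. *)
move=> cF dF FM; pose N := `|M| + 1.
have MN : M < N by apply: le_lt_trans (ler_norm M) _; rewrite ltrDl.
have N0 : 0 < N by rewrite ltr_wpDl.
pose I : set R := `[- N, N]%classic.
transitivity (\int[lebesgue_measure]_(x in I) ('D_1 F x)%:E)%E.
  rewrite [RHS]integral_mkcond; apply: eq_integral => x _.
  rewrite patchE; case: ifPn => //; rewrite notin_setE /I /= in_itv /= => nI.
  rewrite (derive_outside (M := M))//; apply: lt_trans MN _; rewrite ltNge.
  by apply/negP; rewrite ler_norml => /nI.
have cF' : continuous F by move=> x; apply/differentiable_continuous/derivable1_diffP.
rewrite (@continuous_FTC2 _ _ F).
- rewrite !FM ?normrN ?(gtr0_norm N0)//; first by rewrite subee.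
- lra.
- exact: continuous_subspaceT.
- split=> [x _||]; first exact: dF.
  + by apply: cvg_at_right_filter; exact: cF'.
  + by apply: cvg_at_left_filter; exact: cF'.
- by move=> x _; rewrite derive1E.
Qed.

(** By Fubini the variable [x] is integrated innermost, and each slice is the derivative of a
    function of bounded support. *)
Lemma integral_D1 g : continuous (fun p => 'D_(1, 0) g p) ->
    (forall p, derivable g p (1, 0)) -> bounded_support g ->
  (\int[mu]_p ('D_(1, 0) g p)%:E = 0)%E.
Proof.
move=> cD dg [M gM].
have iD : mu.-integrable setT (EFin \o (fun p => 'D_(1, 0) g p)).
  apply: bounded_support_integrable => //; exists M => p Mp.
  exact: (derive_outside _ gM).
rewrite -(integral21_prod_meas1 iD); apply: integral0_eq => y _.
rewrite /fubini_G /=; under eq_integral do rewrite derive_slice1 /=.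
apply: (@integral_derive_bounded_support _ M).
- rewrite (_ : (fun x => _) = fun x => 'D_(1, 0) g (x, y)); last first.
    by apply/funext => x; rewrite derive_slice1.
  exact (@continuous_slice1 (fun p => 'D_(1, 0) g p) y cD).
- move=> x; exact ((derivable_slice1 g (x, y)).1 (dg (x, y))).
- move=> x Mx; apply: gM; apply: lt_le_trans Mx _.
  by rewrite prod_normE le_max lexx.
Qed.

Lemma integral_D2 g : continuous (fun p => 'D_(0, 1) g p) ->
    (forall p, derivable g p (0, 1)) -> bounded_support g ->
  (\int[mu]_p ('D_(0, 1) g p)%:E = 0)%E.
Proof.
move=> cD dg [M gM].
have iD : mu.-integrable setT (EFin \o (fun p => 'D_(0, 1) g p)).
  apply: bounded_support_integrable => //; exists M => p Mp.
  exact: (derive_outside _ gM).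
rewrite -(integral12_prod_meas1 iD); apply: integral0_eq => x _.
rewrite /fubini_F /=; under eq_integral do rewrite derive_slice2 /=.
apply: (@integral_derive_bounded_support _ M).
- rewrite (_ : (fun y => _) = fun y => 'D_(0, 1) g (x, y)); last first.
    by apply/funext => y; rewrite derive_slice2.
  exact (@continuous_slice2 (fun p => 'D_(0, 1) g p) x cD).
- move=> y; exact ((derivable_slice2 g (x, y)).1 (dg (x, y))).
- move=> y My; apply: gM; apply: lt_le_trans My _.
  by rewrite prod_normE le_max lexx orbT.
Qed.

End bounded_support.

(** * Symmetry of second partial derivatives *)

Section clairaut.
Variable R : realType.

(** The mean value theorem is applied to [s |-> G s (y + h) - G s y], and then to [G1 s] at the
    point [s] so found. *)
Lemma mixed_difference_MVT (G G1 G21 : R -> R -> R) (x y h : R) : 0 < h ->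
    (forall s t : R, is_derive s 1 (G^~ t) (G1 s t)) ->
    (forall s t : R, is_derive t 1 (G1 s) (G21 s t)) ->
  exists s t, [/\ `|s - x| < h, `|t - y| < h &
    G (x + h) (y + h) - G (x + h) y - G x (y + h) + G x y = G21 s t * h ^+ 2].
Proof.
move=> h0 dG dG1.
have is_derive_cont (F dF : R -> R) (A : set R) :
    (forall s : R, is_derive s 1 F (dF s)) -> {within A, continuous F}.
  move=> dF'; apply: continuous_subspaceT => s.
  by apply/differentiable_continuous/derivable1_diffP; case: (dF' s).
pose F s := G s (y + h) - G s y.
have dF (s : R) : is_derive s 1 F (G1 s (y + h) - G1 s y) by exact: is_deriveB.
have [||s + Fs] := @MVT _ F (fun s => G1 s (y + h) - G1 s y) x (x + h).
- by rewrite ltrDl.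
- exact: is_derive_cont dF.
rewrite in_itv /= => /andP[xs sx].
have [||t + Gt] := @MVT _ (G1 s) (G21 s) y (y + h).
- by rewrite ltrDl.
- exact: is_derive_cont (dG1 s).
rewrite in_itv /= => /andP[yt ty].
exists s, t; split; [rewrite ltr_norml; lra|rewrite ltr_norml; lra|].
move: Fs; rewrite Gt /F (addrC x h) (addrC y h) !addrK; lra.
Qed.

Lemma continuous_eq_at_nearby (A B : R * R -> R) (p : R * R) :
    continuous A -> continuous B ->
    (forall h, 0 < h -> exists q q', [/\ ball p h q, ball p h q' & A q = B q']) ->
  A p = B p.
Proof.
move=> cA cB H; apply/eqP; rewrite -subr_eq0 -normr_le0 leNgt; apply/negP => e0.
set e := `|A p - B p| / 2; have e1 : 0 < e by rewrite divr_gt0.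
have /cvgrPdist_lt /(_ e e1) /nbhs_ballP[r r0 Ar] := cA p.
have /cvgrPdist_lt /(_ e e1) /nbhs_ballP[r' r'0 Br] := cB p.
have [|q [q' [pq pq' AB]]] := H (Num.min r r'); first by rewrite lt_min r0.
have h1 : `|A p - A q| < e.
  by apply: Ar; apply: le_ball pq; rewrite ge_min lexx.
have h2 : `|B p - B q'| < e.
  by apply: Br; apply: le_ball pq'; rewrite ge_min lexx orbT.
have : `|A p - B p| < `|A p - B p|; last by rewrite ltxx.
have := ler_normB (A p - A q) (B p - B q').
rewrite (_ : A p - A q - (B p - B q') = A p - B p); last by rewrite AB; ring.
rewrite /e in h1 h2; lra.
Qed.

Lemma is_derive_slice1 (g : R * R -> R) p : derivable g p (1, 0) ->
  is_derive p.1 1 (fun t => g (t, p.2)) ('D_(1, 0) g p).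
Proof.
move=> dg; rewrite derive_slice1.
exact (DeriveDef ((derivable_slice1 g p).1 dg) erefl).
Qed.

Lemma is_derive_slice2 (g : R * R -> R) p : derivable g p (0, 1) ->
  is_derive p.2 1 (fun t => g (p.1, t)) ('D_(0, 1) g p).
Proof.
move=> dg; rewrite derive_slice2.
exact (DeriveDef ((derivable_slice2 g p).1 dg) erefl).
Qed.

(** The same second difference over a square of side [h] equals [h^2] times either mixed derivative
    at some nearby point; continuity lets [h] tend to 0. *)
Lemma Clairaut (g : R * R -> R) p : Ck 2 g ->
  'D_(0, 1) ('D_(1, 0) g) p = 'D_(1, 0) ('D_(0, 1) g) p.
Proof.
move=> [_ [d1 d2 [_ [_ d21 _ [c21 _]]] [_ [d12 _ [c12 _] _]]]].
apply: (continuous_eq_at_nearby c21 c12) => h h0; case: p => x y.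
have [s [t [sx ty E]]] := @mixed_difference_MVT (fun s t => g (s, t))
  (fun s t => 'D_(1, 0) g (s, t))
  (fun s t => 'D_(0, 1) ('D_(1, 0) g) (s, t)) x y h h0
  (fun s t => is_derive_slice1 (d1 (s, t)))
  (fun s t => is_derive_slice2 (d21 (s, t))).
have [t' [s' [ty' sx' E']]] := @mixed_difference_MVT (fun t s => g (s, t))
  (fun t s => 'D_(0, 1) g (s, t))
  (fun t s => 'D_(1, 0) ('D_(0, 1) g) (s, t)) y x h h0
  (fun t s => is_derive_slice2 (d2 (s, t)))
  (fun t s => is_derive_slice1 (d12 (s, t))).
exists (s, t), (s', t'); split.
- by split; rewrite /ball /= distrC.
- by split; rewrite /ball /= distrC.
apply: (mulIf (x := h ^+ 2)); first by rewrite expf_neq0// gt_eqF.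
exact (etrans (esym E)
  (etrans (congr1 (fun z => z + g (x, y)) (addrAC _ _ _)) E')).
Qed.

End clairaut.

(** * The module of real test functions *)

Section test_functions.
Variable R : realType.
Local Notation mu := (plane_measure R).

Definition test_fun (g : R * R -> R) : Prop :=
  (forall n, Ck n g) /\ bounded_support g.

Lemma test_fun_submod : GRing.submod_closed [pred g : R * R -> R | `[< test_fun g >]].
Proof.
split=> [|t f g /asboolP[Cf [M fM]] /asboolP[Cg [N gN]]]; apply/asboolP.
  by split=> [n|]; [exact: (Ck_cst n 0)|exists 0].
split=> [n|]; first exact: (CkD (CkZ t (Cf n)) (Cg n)).
exists (Num.max M N) => p; rewrite gt_max => /andP[Mp Np].
by rewrite /= -[LHS]/(t * f p + g p) fM// gN// mulr0 addr0.
Qed.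

HB.instance Definition _ := GRing.isSubmodClosed.Build R (R * R -> R)
  [pred g : R * R -> R | `[< test_fun g >]] test_fun_submod.

(** Bundling gives test functions a module structure, on which the abstract estimates for linear
    operators apply. *)
Record test := Test {
  tval :> R * R -> R;
  tvalP : tval \in [pred g : R * R -> R | `[< test_fun g >]] }.

HB.instance Definition _ := [isSub for tval].
HB.instance Definition _ := [Choice of test by <:].
HB.instance Definition _ := [SubChoice_isSubLmodule of test by <:].

End test_functions.

(** * Test functions and weighted integration by parts *)

Section test_operators.
Variable R : realType.
Local Notation mu := (plane_measure R).
Implicit Types u v w : test R.

Lemma testP u : test_fun u.
Proof. exact/asboolP/(tvalP u). Qed.

Lemma test_smooth u n : Ck n u. Proof. by have [] := testP u. Qed.

Lemma test_bounded u : bounded_support u. Proof. by have [] := testP u. Qed.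

Definition mk_test (g : R * R -> R) (tg : test_fun g) : test R :=
  Test (asboolT tg : g \in [pred g | `[< test_fun g >]]).

Lemma test_ext u v : (forall p, u p = v p) -> u = v.
Proof. by move=> uv; apply: val_inj; apply/funext. Qed.

Lemma testD u v p : (u + v) p = u p + v p. Proof. by []. Qed.
Lemma testZ (t : R) u p : (t *: u) p = t * u p. Proof. by []. Qed.
Lemma testN u p : (- u) p = - u p. Proof. by []. Qed.

Lemma test_fun_dx u : test_fun (fun p => 'D_(1, 0) u p).
Proof.
split=> [n|]; first by have [_ []] := test_smooth u n.+1.
by have [M uM] := test_bounded u; exists M => p; exact: derive_outside.
Qed.

Lemma test_fun_dy u : test_fun (fun p => 'D_(0, 1) u p).
Proof.
split=> [n|]; first by have [_ []] := test_smooth u n.+1.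
by have [M uM] := test_bounded u; exists M => p; exact: derive_outside.
Qed.

Lemma test_fun_mul (f : R * R -> R) u : (forall n, Ck n f) ->
  test_fun (fun p => f p * u p).
Proof.
move=> Cf; split=> [n|]; first exact (CkM (Cf n) (test_smooth u n)).
by have [M uM] := test_bounded u; exists M => p Mp; rewrite uM// mulr0.
Qed.

End test_operators.

(* Sealing keeps unification from comparing the bodies of distinct operators. *)
HB.lock Definition dx (R : realType) (u : test R) := mk_test (test_fun_dx u).
HB.lock Definition dy (R : realType) (u : test R) := mk_test (test_fun_dy u).
HB.lock Definition mulx (R : realType) (u : test R) :=
  mk_test (test_fun_mul u (@Ck_fst R)).
HB.lock Definition muly (R : realType) (u : test R) :=
  mk_test (test_fun_mul u (@Ck_snd R)).

Section weighted_product.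
Variable R : realType.
Local Notation mu := (plane_measure R).
Implicit Types u v w : test R.

Lemma dxE u p : dx u p = 'D_(1, 0) u p. Proof. by rewrite unlock. Qed.
Lemma dyE u p : dy u p = 'D_(0, 1) u p. Proof. by rewrite unlock. Qed.
Lemma mulxE u p : mulx u p = p.1 * u p. Proof. by rewrite unlock. Qed.
Lemma mulyE u p : muly u p = p.2 * u p. Proof. by rewrite unlock. Qed.

Lemma derivable_test1 u p : derivable u p (1, 0).
Proof. by have [_ []] := test_smooth u 1. Qed.

Lemma derivable_test2 u p : derivable u p (0, 1).
Proof. by have [_ []] := test_smooth u 1. Qed.

Lemma dx_linear : linear (@dx R).
Proof.
move=> t u v; apply: test_ext => p.
have du := @derivable_test1 u p; have dv := @derivable_test1 v p.
rewrite testD testZ !dxE -[LHS]/('D_(1, 0) (t *: (u : R * R -> R) + v) p).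
rewrite (deriveD (@derivableZ _ _ _ _ t _ _ du) dv) (@deriveZ _ _ _ _ t _ _ du).
exact erefl.
Qed.

Lemma dy_linear : linear (@dy R).
Proof.
move=> t u v; apply: test_ext => p.
have du := @derivable_test2 u p; have dv := @derivable_test2 v p.
rewrite testD testZ !dyE -[LHS]/('D_(0, 1) (t *: (u : R * R -> R) + v) p).
rewrite (deriveD (@derivableZ _ _ _ _ t _ _ du) dv) (@deriveZ _ _ _ _ t _ _ du).
exact erefl.
Qed.

Lemma mulx_linear : linear (@mulx R).
Proof.
by move=> t u v; apply: test_ext => p; rewrite !(testD, testZ, mulxE); ring.
Qed.

Lemma muly_linear : linear (@muly R).
Proof.
by move=> t u v; apply: test_ext => p; rewrite !(testD, testZ, mulyE); ring.
Qed.

HB.instance Definition _ := GRing.isLinear.Build R (test R) (test R) _ (@dx R) dx_linear.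
HB.instance Definition _ := GRing.isLinear.Build R (test R) (test R) _ (@dy R) dy_linear.
HB.instance Definition _ :=
  GRing.isLinear.Build R (test R) (test R) _ (@mulx R) mulx_linear.
HB.instance Definition _ :=
  GRing.isLinear.Build R (test R) (test R) _ (@muly R) muly_linear.

Lemma dxdyC u : dx (dy u) = dy (dx u).
Proof.
apply: test_ext => p; rewrite dxE dyE.
rewrite (_ : (dy u : R * R -> R) = 'D_(0, 1) u); last exact/funext/dyE.
rewrite (_ : (dx u : R * R -> R) = 'D_(1, 0) u); last exact/funext/dxE.
by rewrite (Clairaut p (test_smooth u 2)).
Qed.

Lemma dx_mulx u : dx (mulx u) = mulx (dx u) + u.
Proof.
apply: test_ext => p; have du := @derivable_test1 u p.
have mulM : (mulx u : R * R -> R) = fun q => q.1 * u q by exact/funext/mulxE.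
have dc : derivable (fun q : R * R => q.1) p (1, 0).
  by apply/derivable_slice1; exact: derivable_id.
have Dc : 'D_(1, 0) (fun q : R * R => q.1) p = 1.
  by rewrite derive_slice1 derive_id.
rewrite testD mulxE !dxE mulM (deriveM dc du) Dc.
by rewrite /GRing.scale /= mulr1.
Qed.

Lemma dy_muly u : dy (muly u) = muly (dy u) + u.
Proof.
apply: test_ext => p; have du := @derivable_test2 u p.
have mulM : (muly u : R * R -> R) = fun q => q.2 * u q by exact/funext/mulyE.
have dc : derivable (fun q : R * R => q.2) p (0, 1).
  by apply/derivable_slice2; exact: derivable_id.
have Dc : 'D_(0, 1) (fun q : R * R => q.2) p = 1.
  by rewrite derive_slice2 derive_id.
rewrite testD mulyE !dyE mulM (deriveM dc du) Dc.
by rewrite /GRing.scale /= mulr1.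
Qed.

Lemma dx_muly u : dx (muly u) = muly (dx u).
Proof.
apply: test_ext => p; have du := @derivable_test1 u p.
have mulM : (muly u : R * R -> R) = fun q => q.2 * u q by exact/funext/mulyE.
have dc : derivable (fun q : R * R => q.2) p (1, 0).
  by apply/derivable_slice1; exact: derivable_cst.
have Dc : 'D_(1, 0) (fun q : R * R => q.2) p = 0.
  by rewrite derive_slice1 derive_cst.
rewrite mulyE !dxE mulM (deriveM dc du) Dc.
by rewrite /GRing.scale /= mulr0 addr0.
Qed.

Lemma dy_mulx u : dy (mulx u) = mulx (dy u).
Proof.
apply: test_ext => p; have du := @derivable_test2 u p.
have mulM : (mulx u : R * R -> R) = fun q => q.1 * u q by exact/funext/mulxE.
have dc : derivable (fun q : R * R => q.1) p (0, 1).
  by apply/derivable_slice2; exact: derivable_cst.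
have Dc : 'D_(0, 1) (fun q : R * R => q.1) p = 0.
  by rewrite derive_slice2 derive_cst.
rewrite mulxE !dyE mulM (deriveM dc du) Dc.
by rewrite /GRing.scale /= mulr0 addr0.
Qed.

(** This is [exp |z|^2], with a positive exponent. *)
Definition weight (p : R * R) : R := expR (p.1 ^+ 2 + p.2 ^+ 2).

Lemma is_derive_weight1 (x y : R) :
  is_derive x 1 (fun t => weight (t, y)) (2 * x * weight (x, y)).
Proof.
have d2 : is_derive x 1 (fun t : R => t ^+ 2 + y ^+ 2) (2 * x).
  rewrite (_ : (fun t : R => _) = (id * id : R -> R) + cst (y ^+ 2)); last first.
    by apply/funext => t; rewrite expr2.
  have dI := is_derive_id x (1 : R).
  have dS := is_deriveD (is_deriveM dI dI) (is_derive_cst (y ^+ 2) x (1 : R)).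
  by apply: (is_derive_eq dS); rewrite /GRing.scale /=; ring.
rewrite mulrC; exact: (is_derive1_comp (is_derive_expR _) d2).
Qed.

Lemma is_derive_weight2 (x y : R) :
  is_derive y 1 (fun t => weight (x, t)) (2 * y * weight (x, y)).
Proof.
have := is_derive_weight1 y x.
by rewrite (_ : (fun t => _) = fun t => weight (x, t));
  [rewrite /weight /= addrC|apply/funext => t; rewrite /weight /= addrC].
Qed.

Lemma continuous_weight : continuous weight.
Proof.
move=> p; apply: (@continuous_comp _ _ _ (fun p : R * R => p.1 ^+ 2 + p.2 ^+ 2) expR).
  apply: (Ck_continuous (n := 0)).
  exact (CkD (CkM (@Ck_fst R 0) (@Ck_fst R 0)) (CkM (@Ck_snd R 0) (@Ck_snd R 0))).
exact: continuous_expR.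
Qed.

Lemma weight_gt0 p : 0 < weight p. Proof. exact: expR_gt0. Qed.

Lemma test_weight_integrable u v :
  mu.-integrable setT (EFin \o (fun p => u p * v p * weight p)).
Proof.
apply: bounded_support_integrable.
  move=> p; apply: cvgM; last exact: continuous_weight.
  exact (@Ck_continuous R 0 _ (CkM (test_smooth u 0) (test_smooth v 0)) p).
by have [M uM] := test_bounded u; exists M => p /uM ->; rewrite !mul0r.
Qed.

Definition wdot u v : R := Rintegral mu setT (fun p => u p * v p * weight p).

Lemma wdotC u v : wdot u v = wdot v u.
Proof. by apply: eq_Rintegral => p _; rewrite [u p * _]mulrC. Qed.

Lemma wdotDl u v w : wdot (u + v) w = wdot u w + wdot v w.
Proof.
rewrite /wdot -RintegralD//; do ?exact: test_weight_integrable.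
by apply: eq_Rintegral => p _; rewrite testD; ring.
Qed.

Lemma wdotZl (t : R) u w : wdot (t *: u) w = t * wdot u w.
Proof.
rewrite /wdot -RintegralZl//; do ?exact: test_weight_integrable.
by apply: eq_Rintegral => p _; rewrite testZ; ring.
Qed.

Lemma wdotDr u v w : wdot w (u + v) = wdot w u + wdot w v.
Proof. by rewrite wdotC wdotDl !(wdotC w). Qed.

Lemma wdotZr (t : R) u w : wdot w (t *: u) = t * wdot w u.
Proof. by rewrite wdotC wdotZl !(wdotC w). Qed.

Lemma wdot_ge0 u : 0 <= wdot u u.
Proof.
by apply: Rintegral_ge0 => p _; rewrite mulr_ge0 ?(ltW (weight_gt0 p))// -expr2 sqr_ge0.
Qed.

Lemma wdot_mulx u v : wdot (mulx u) v = wdot u (mulx v).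
Proof. by apply: eq_Rintegral => p _; rewrite !mulxE; ring. Qed.

Lemma wdot_muly u v : wdot (muly u) v = wdot u (muly v).
Proof. by apply: eq_Rintegral => p _; rewrite !mulyE; ring. Qed.

(** The derivative of [u v weight] has integral zero, and the derivative of the weight contributes
    the term in [M]. The direction [e] is abstract so that both partial derivatives share the
    argument. *)
Lemma wdot_derive (e : R * R) (D M : test R -> test R) (c : R * R -> R) u v :
    (forall u p, derivable u p e) -> (forall u p, D u p = 'D_e u p) ->
    (forall u p, M u p = c p * u p) ->
    (forall p, is_derive p e weight (2 * c p * weight p)) ->
    (forall g, continuous (fun p => 'D_e g p) -> (forall p, derivable g p e) ->
      bounded_support g -> (\int[mu]_p ('D_e g p)%:E = 0)%E) ->
  wdot (D u) v = - wdot u (D v) - 2 * wdot u (M v).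
Proof.
move=> dtest DE ME dweight int0; pose g p := u p * v p * weight p.
have dg p : is_derive p e g (D u p * v p * weight p + u p * D v p * weight p
     + 2 * (u p * M v p * weight p)).
  have [dw wE] := dweight p; have du := @dtest u p; have dv := @dtest v p.
  have duv : derivable (fun p => u p * v p) p e by exact (derivableM du dv).
  apply: DeriveDef; first exact (derivableM duv dw).
  by rewrite (deriveM duv dw) (deriveM du dv) wE !DE ME /GRing.scale /=; ring.
suff : wdot (D u) v + wdot u (D v) + 2 * wdot u (M v) = 0 by lra.
have i1 := test_weight_integrable (D u) v.
have i2 := test_weight_integrable u (D v).
have i3 := test_weight_integrable u (2 *: M v).
have -> : 2 * wdot u (M v) = wdot u (2 *: M v) by rewrite wdotZr.
rewrite /wdot -RintegralD// -RintegralD//; last first.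
  by have := integrableD measurableT i1 i2; apply: eq_integrable.
transitivity (Rintegral mu setT (fun p => 'D_e g p)).
  by apply: eq_Rintegral => p _; have [_ ->] := dg p; rewrite testZ; ring.
rewrite /Rintegral int0//.
- rewrite (_ : (fun p => _) = fun p =>
      (D u p * v p + u p * D v p + 2 * (u p * M v p)) * weight p).
    move=> p; apply: cvgM; last exact: continuous_weight.
    have C w := @test_smooth R w 0.
    exact (@Ck_continuous R 0 _ (CkD (CkD (CkM (C (D u)) (C v))
      (CkM (C u) (C (D v)))) (CkZ 2 (CkM (C u) (C (M v))))) p).
  by apply/funext => p; have [_ ->] := dg p; ring.
- have [N uN] := test_bounded u; exists N => p /uN.
  by rewrite /g => ->; rewrite !mul0r.
Qed.

Lemma wdot_dx u v : wdot (dx u) v = - wdot u (dx v) - 2 * wdot u (mulx v).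
Proof.
apply: (@wdot_derive (1, 0) (@dx R) (@mulx R) fst) => // [||||g].
- exact: derivable_test1.
- exact: dxE.
- exact: mulxE.
- move=> [x y]; have [d1 d2] := is_derive_weight1 x y.
  by apply: DeriveDef; [exact/derivable_slice1|rewrite derive_slice1].
- exact: integral_D1.
Qed.

Lemma wdot_dy u v : wdot (dy u) v = - wdot u (dy v) - 2 * wdot u (muly v).
Proof.
apply: (@wdot_derive (0, 1) (@dy R) (@muly R) snd) => // [||||g].
- exact: derivable_test2.
- exact: dyE.
- exact: mulyE.
- move=> [x y]; have [d1 d2] := is_derive_weight2 x y.
  by apply: DeriveDef; [exact/derivable_slice2|rewrite derive_slice2].
- exact: integral_D2.
Qed.

End weighted_product.

(** * Wirtinger operators on test functions *)

Section complex_test_operators.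
Variable R : realType.
Local Notation V := (test R * test R)%type.
Implicit Types u v : V.

(** A pair stands for [u.1 + i u.2]; the components are the real and imaginary parts of the
    Wirtinger derivative. *)
Definition Dz u : V := (2^-1 *: (dx u.1 + dy u.2), 2^-1 *: (dx u.2 - dy u.1)).
Definition Dzb u : V := (2^-1 *: (dx u.1 - dy u.2), 2^-1 *: (dx u.2 + dy u.1)).

(* Adjoints of [Dz] and [Dzb] for the weight [exp |z|^2]: [- (Dzb + z)] and
   [- (Dz + conj z)]. *)
Definition Dz_adj u : V :=
  (- (2^-1 *: (dx u.1 - dy u.2) + (mulx u.1 - muly u.2)),
   - (2^-1 *: (dx u.2 + dy u.1) + (mulx u.2 + muly u.1))).
Definition Dzb_adj u : V :=
  (- (2^-1 *: (dx u.1 + dy u.2) + (mulx u.1 + muly u.2)),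
   - (2^-1 *: (dx u.2 - dy u.1) + (mulx u.2 - muly u.1))).
Definition cmul (c1 c2 : R) u : V := (c1 *: u.1 - c2 *: u.2, c1 *: u.2 + c2 *: u.1).

(** The real part of the weighted Hermitian product. *)
Definition cdot u v : R := wdot u.1 v.1 + wdot u.2 v.2.

Lemma dxD (u v : test R) : dx (u + v) = dx u + dx v.
Proof. exact: linearD. Qed.
Lemma dxN (u : test R) : dx (- u) = - dx u.
Proof. exact: linearN. Qed.
Lemma dxZ (t : R) (u : test R) : dx (t *: u) = t *: dx u.
Proof. exact: linearZ_LR. Qed.
Lemma dyD (u v : test R) : dy (u + v) = dy u + dy v.
Proof. exact: linearD. Qed.
Lemma dyN (u : test R) : dy (- u) = - dy u.
Proof. exact: linearN. Qed.
Lemma dyZ (t : R) (u : test R) : dy (t *: u) = t *: dy u.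
Proof. exact: linearZ_LR. Qed.
(** [opE] pushes derivatives inward to the arguments and [ptE] evaluates at a point; operator
    identities then reduce to [ring] or [field]. *)
Definition opE := (dxD, dyD, dxN, dyN, dxZ, dyZ,
  @dx_mulx R, @dy_muly R, @dx_muly R, @dy_mulx R, @dxdyC R).
Definition ptE := (@testD R, @testZ R, @testN R, @mulxE R, @mulyE R).

Lemma Dz_linear : linear Dz.
Proof.
move=> t u v; apply: injective_projections => /=; rewrite !opE;
  by apply: test_ext => p; rewrite !ptE; ring.
Qed.

Lemma Dzb_linear : linear Dzb.
Proof.
move=> t u v; apply: injective_projections => /=; rewrite !opE;
  by apply: test_ext => p; rewrite !ptE; ring.
Qed.

Lemma Dz_adj_linear : linear Dz_adj.
Proof.
move=> t u v; apply: injective_projections => /=; rewrite !opE;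
  by apply: test_ext => p; rewrite !ptE; ring.
Qed.

Lemma Dzb_adj_linear : linear Dzb_adj.
Proof.
move=> t u v; apply: injective_projections => /=; rewrite !opE;
  by apply: test_ext => p; rewrite !ptE; ring.
Qed.

Lemma cmul_linear c1 c2 : linear (cmul c1 c2).
Proof.
move=> t u v; apply: injective_projections => /=;
  by apply: test_ext => p; rewrite !ptE; ring.
Qed.

HB.instance Definition _ := GRing.isLinear.Build R V V _ Dz Dz_linear.
HB.instance Definition _ := GRing.isLinear.Build R V V _ Dzb Dzb_linear.
HB.instance Definition _ := GRing.isLinear.Build R V V _ Dz_adj Dz_adj_linear.
HB.instance Definition _ := GRing.isLinear.Build R V V _ Dzb_adj Dzb_adj_linear.
HB.instance Definition _ c1 c2 :=
  GRing.isLinear.Build R V V _ (cmul c1 c2) (cmul_linear c1 c2).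

(** The derivatives commute, and the extra [u] comes from [d/dz] acting on the factor [z] in the
    adjoint. *)
Lemma Dz_ccr u : Dz_adj (Dz u) = Dz (Dz_adj u) + u.
Proof.
by apply: injective_projections => /=; rewrite !opE;
  apply: test_ext => p; rewrite !ptE; field.
Qed.

Lemma Dzb_ccr u : Dzb_adj (Dzb u) = Dzb (Dzb_adj u) + u.
Proof.
by apply: injective_projections => /=; rewrite !opE;
  apply: test_ext => p; rewrite !ptE; field.
Qed.

(** The factor [z] is annihilated by [d/dzbar], so the two pairs do not interact. *)
Lemma Dz_adj_Dzb u : Dz_adj (Dzb u) = Dzb (Dz_adj u).
Proof.
by apply: injective_projections => /=; rewrite !opE;
  apply: test_ext => p; rewrite !ptE; field.
Qed.

Lemma Dz_adj_cmul c1 c2 u : Dz_adj (cmul c1 c2 u) = cmul c1 c2 (Dz_adj u).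
Proof.
by apply: injective_projections => /=; rewrite !opE;
  apply: test_ext => p; rewrite !ptE; field.
Qed.

Lemma Dzb_adj_cmul c1 c2 u : Dzb_adj (cmul c1 c2 u) = cmul c1 c2 (Dzb_adj u).
Proof.
by apply: injective_projections => /=; rewrite !opE;
  apply: test_ext => p; rewrite !ptE; field.
Qed.

Lemma cdotC u v : cdot u v = cdot v u.
Proof. by rewrite /cdot wdotC (wdotC u.2). Qed.

Lemma cdotDl u v w : cdot (u + v) w = cdot u w + cdot v w.
Proof. by rewrite /cdot /= !wdotDl; ring. Qed.

Lemma cdotZl (t : R) u w : cdot (t *: u) w = t * cdot u w.
Proof. by rewrite /cdot /= !wdotZl; ring. Qed.

Lemma cdot_ge0 u : 0 <= cdot u u.
Proof. by rewrite addr_ge0 ?wdot_ge0. Qed.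

Let wdotNl (u v : test R) : wdot (- u) v = - wdot u v.
Proof. by rewrite -scaleN1r wdotZl mulN1r. Qed.
Let wdotNr (u v : test R) : wdot u (- v) = - wdot u v.
Proof. by rewrite -scaleN1r wdotZr mulN1r. Qed.

Definition wdotE :=
  (wdotDl, wdotDr, wdotZl, wdotZr, wdotNl, wdotNr, wdot_dx, wdot_dy).

(** Integration by parts, where [d/dzbar] of the weight is [z] times the weight. *)
Lemma Dz_adjP u v : cdot (Dz_adj u) v = cdot u (Dz v).
Proof. by rewrite /cdot /= !wdotE !(wdot_mulx, wdot_muly); field. Qed.

Lemma Dzb_adjP u v : cdot (Dzb_adj u) v = cdot u (Dzb v).
Proof. by rewrite /cdot /= !wdotE !(wdot_mulx, wdot_muly); field. Qed.

Lemma cmul_adjP c1 c2 u v : cdot (cmul c1 c2 u) v = cdot u (cmul c1 (- c2) v).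
Proof. by rewrite /cdot /= !wdotE; ring. Qed.

Lemma cmul_norm c1 c2 u :
  cdot (cmul c1 c2 u) (cmul c1 c2 u) = cdot (cmul c1 (- c2) u) (cmul c1 (- c2) u).
Proof. by rewrite /cdot /= !wdotE (wdotC u.2 u.1); ring. Qed.

Lemma Dz_Dzb_lower_bound k c1 c2 u (v := iter k Dz (iter k Dzb u) + cmul c1 c2 u) :
  (0 < k)%N -> (k`!%:R) ^+ 2 * cdot u u <= cdot v v.
Proof.
by move=> k0; apply: (@ladder_lower_bound R V cdot cdotC cdotDl cdotZl cdot_ge0
  Dz_adj Dz Dzb_adj Dzb (cmul c1 c2) (cmul c1 (- c2)) k Dz_adjP Dz_ccr
  Dzb_adjP Dzb_ccr Dz_adj_Dzb (cmul_adjP c1 c2) (cmul_norm c1 c2)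
  (Dz_adj_cmul c1 c2) (Dzb_adj_cmul c1 c2) k0).
Qed.

End complex_test_operators.

(** * Solution in real form *)

Section square_integrable_dot.
Context d (T : measurableType d) (R : realType).
Variable mu : {measure set T -> \bar R}.

Definition L2dot (f g : T -> R) : R := Rintegral mu setT (fun x => f x * g x).

Lemma L2dotC f g : L2dot f g = L2dot g f.
Proof. by apply: eq_Rintegral => x _; rewrite mulrC. Qed.

Lemma sq_integrable_lin (t : R) f g : sq_integrable mu f -> sq_integrable mu g ->
  sq_integrable mu (fun x => f x + t * g x).
Proof.
move=> sf sg; have [mf if2] := sf; have [mg ig2] := sg; split.
  by apply: measurable_funD => //; exact: measurable_funM.
have ifg := sq_integrable_mul sf sg.
rewrite (_ : (fun x => _) = (fun x => (f x ^+ 2)%:E + ((2 * t)%:E * (f x * g x)%:E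
    + (t ^+ 2)%:E * (g x ^+ 2)%:E))%E).
  apply: integrableD => //; apply: integrableD => //; exact: integrableZl.
by apply/funext => x; rewrite -!EFinM -!EFinD; congr (_%:E); ring.
Qed.

Lemma L2dot_linl (t : R) f g h :
    sq_integrable mu f -> sq_integrable mu g -> sq_integrable mu h ->
  L2dot (fun x => f x + t * g x) h = L2dot f h + t * L2dot g h.
Proof.
move=> sf sg sh; have ifh := sq_integrable_mul sf sh.
have igh := sq_integrable_mul sg sh.
rewrite /L2dot -RintegralZl// -RintegralD//; last first.
  by have := integrableZl measurableT t igh.
by apply: eq_Rintegral => x _; ring.
Qed.

Lemma L2dot_ge0 f : 0 <= L2dot f f.
Proof. by apply: Rintegral_ge0 => x _; rewrite -expr2 sqr_ge0. Qed.

Lemma L2dot_sq_lin (t : R) f g : sq_integrable mu f -> sq_integrable mu g ->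
  L2dot (fun x => f x + t * g x) (fun x => f x + t * g x) =
  L2dot f f + 2 * t * L2dot f g + t ^+ 2 * L2dot g g.
Proof.
move=> sf sg; have sfg := sq_integrable_lin t sf sg.
rewrite L2dot_linl// (L2dotC f) (L2dotC g) !L2dot_linl// (L2dotC g f); ring.
Qed.

End square_integrable_dot.

Section real_solution.
Variable R : realType.
Local Notation mu := (plane_measure R).
Local Notation V := (test R * test R)%type.
Local Notation dot := (L2dot mu).

(** The square root of [weight]; multiplying by it trades the weighted product for the unweighted
    one. *)
Definition half_weight (p : R * R) : R := expR ((p.1 ^+ 2 + p.2 ^+ 2) / 2).

Lemma half_weight_gt0 p : 0 < half_weight p. Proof. exact: expR_gt0. Qed.

Lemma sqr_half_weight p : half_weight p ^+ 2 = weight p.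
Proof. by rewrite expr2 -expRD /weight -splitr. Qed.

Lemma continuous_half_weight : continuous half_weight.
Proof.
move=> p.
apply: (@continuous_comp _ _ _ (fun p : R * R => (p.1 ^+ 2 + p.2 ^+ 2) / 2) expR).
  apply: cvgM; last exact: cvg_cst.
  exact (@Ck_continuous R 0 _ (CkD (CkM (@Ck_fst R 0) (@Ck_fst R 0))
    (CkM (@Ck_snd R 0) (@Ck_snd R 0))) p).
exact: continuous_expR.
Qed.

Definition scaled (u : test R) (p : R * R) : R := u p * half_weight p.

Lemma scaled_sq_integrable u : sq_integrable mu (scaled u).
Proof.
split.
  apply: continuous_plane_measurable => p; apply: cvgM.
    exact (@Ck_continuous R 0 _ (test_smooth u 0) p).
  exact: continuous_half_weight.
apply: eq_integrable (test_weight_integrable u u) => // p _.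
by rewrite /= /scaled exprMn sqr_half_weight expr2.
Qed.

Lemma scaled_dot u v : dot (scaled u) (scaled v) = wdot u v.
Proof.
by apply: eq_Rintegral => p _; rewrite /scaled -sqr_half_weight; ring.
Qed.

Lemma scaled_lin (t : R) u v :
  scaled (u + t *: v) = fun p => scaled u p + t * scaled v p.
Proof. by apply/funext => p; rewrite /scaled testD testZ; ring. Qed.

Variables (k : nat) (c1 c2 : R) (F1 F2 : R * R -> R).
Hypothesis k0 : (0 < k)%N.
Hypothesis sF1 : sq_integrable mu F1.
Hypothesis sF2 : sq_integrable mu F2.

Definition opA (u : V) : V := iter k (@Dz R) (iter k (@Dzb R) u) + cmul c1 c2 u.
(* The real part of the integral of [f u], where [F1 + i F2] is
   [f exp (- |z|^2 / 2)]. *)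
Definition functional (u : V) : R := dot F1 (scaled u.1) - dot F2 (scaled u.2).

Let N := dot F1 F1 + dot F2 F2.

Lemma iter_linear (g : {linear V -> V}) n (t : R) (u v : V) :
  iter n g (t *: u + v) = t *: iter n g u + iter n g v.
Proof. by elim: n => // n IH; rewrite !iterS IH linearP. Qed.

Lemma opA_linear (t : R) u v : opA (t *: u + v) = t *: opA u + opA v.
Proof.
rewrite /opA !iter_linear linearP scalerDr addrACA; congr (_ + _ + _).
Qed.

Lemma functional_linear (t : R) u v :
  functional (t *: u + v) = t * functional u + functional v.
Proof.
rewrite /functional /= ![t *: _ + _]addrC !scaled_lin !(L2dotC mu F1) !(L2dotC mu F2).
rewrite !L2dot_linl//; do ?exact: scaled_sq_integrable.
by rewrite /GRing.scale /=; ring.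
Qed.

Lemma functional_bound u : functional u ^+ 2 <= N * cdot u u.
Proof.
apply: quadratic_ge0_disc; first exact: cdot_ge0.
move=> t; have s1 := scaled_sq_integrable u.1; have s2 := scaled_sq_integrable u.2.
have := L2dot_ge0 mu (fun p => F1 p + t * scaled u.1 p).
(* The sign of [t] is reversed here because [functional] subtracts its second term. *)
have := L2dot_ge0 mu (fun p => F2 p + (- t) * scaled u.2 p).
rewrite !L2dot_sq_lin// !scaled_dot /functional /cdot /N; lra.
Qed.

(** [P] and [Q] are the L2 limits of the two components of [opA (phi n)] times [half_weight], for
    [phi n] minimising [|opA u|^2 - 2 functional u]. *)
Lemma exists_real_solution : exists P Q : R * R -> R,
  [/\ sq_integrable mu P, sq_integrable mu Q,
    dot P P + dot Q Q <= N / (k`!%:R) ^+ 2 &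
    forall u, dot P (scaled (opA u).1) + dot Q (scaled (opA u).2) = functional u].
Proof.
have kf0 : 0 < k`!%:R :> R by rewrite ltr0n fact_gt0.
have N0 : 0 <= N by rewrite addr_ge0 ?L2dot_ge0.
(* [C] bounds [functional] in the norm of [B]: [functional_bound] gives [sqrt N] and the lower bound
   on [opA] gives the division by [k!]. *)
pose B u v := cdot (opA u) (opA v); pose C := Num.sqrt N / k`!%:R.
have C0 : 0 <= C by rewrite divr_ge0 ?sqrtr_ge0.
have C2 : C ^+ 2 = N / (k`!%:R) ^+ 2 by rewrite /C expr_div_n sqr_sqrtr.
have opAD u v : opA (u + v) = opA u + opA v.
  by rewrite -[u]scale1r opA_linear !scale1r.
have opA0 : opA 0 = 0.
  by apply: (@addrI _ (opA 0)); rewrite -opAD !addr0.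
have opAZ (t : R) u : opA (t *: u) = t *: opA u.
  by rewrite -[t *: u]addr0 opA_linear opA0 addr0.
have fD u v : functional (u + v) = functional u + functional v.
  by rewrite -[u]scale1r functional_linear mul1r !scale1r.
have f0 : functional 0 = 0.
  by apply: (@addrI _ (functional 0)); rewrite -fD !addr0.
have fZ (t : R) u : functional (t *: u) = t * functional u.
  by rewrite -[t *: u]addr0 functional_linear f0 addr0.
have BC u v : B u v = B v u by exact: cdotC.
have BD u v w : B (u + v) w = B u w + B v w by rewrite /B opAD cdotDl.
have BZ (t : R) u w : B (t *: u) w = t * B u w by rewrite /B opAZ cdotZl.
have B0 u : 0 <= B u u by exact: cdot_ge0.
have fB u : functional u ^+ 2 <= C ^+ 2 * B u u.
  apply: le_trans (functional_bound u) _; rewrite C2 -mulrA ler_wpM2l//.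
  rewrite mulrC ler_pdivlMr ?exprn_gt0// mulrC.
  exact: (Dz_Dzb_lower_bound c1 c2 u k0).
(* The rate [4^-n] has square [16^-n], the decay required by [fast_L2_cvg]. *)
have eta0 n : 0 < 4^-1 ^+ n :> R by rewrite exprn_gt0.
have [phi phiP] := minimizing_sequence BC BD BZ B0 fD fZ C0 fB eta0.
have stepB n : B (phi n.+1 - phi n) (phi n.+1 - phi n) <= 4 / 16 ^+ n.
  have [h _ _] := phiP n.+1; apply: le_trans (h n) _.
  have -> : (16 ^+ n)^-1 = (4^-1 ^+ n) ^+ 2 :> R.
    by rewrite [RHS]exprAC [in RHS]exprVn exprVn -(natrX R 4 2).
  rewrite [4^-1 ^+ n.+1]exprS; move: (4^-1 ^+ n) => z.
  by have := sqr_ge0 z; rewrite exprMn; lra.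
pose w1 n := scaled (opA (phi n)).1; pose w2 n := scaled (opA (phi n)).2.
have sw1 n : sq_integrable mu (w1 n) by exact: scaled_sq_integrable.
have sw2 n : sq_integrable mu (w2 n) by exact: scaled_sq_integrable.
have opAB u v : opA (u - v) = opA u - opA v.
  by rewrite opAD -scaleN1r opAZ scaleN1r.
have step1 n : Rintegral mu setT (fun p => (w1 n.+1 p - w1 n p) ^+ 2) <= 4 / 16 ^+ n.
  apply: le_trans (stepB n); rewrite /B opAB /cdot.
  set u := _ - _; rewrite -(scaled_dot u.1).
  rewrite (_ : Rintegral _ _ _ = dot (scaled u.1) (scaled u.1)).
    by rewrite lerDl wdot_ge0.
  apply: eq_Rintegral => p _; rewrite /w1 /scaled.
  rewrite -[u.1]/((opA (phi n.+1)).1 - (opA (phi n)).1) testD testN; ring.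
have step2 n : Rintegral mu setT (fun p => (w2 n.+1 p - w2 n p) ^+ 2) <= 4 / 16 ^+ n.
  apply: le_trans (stepB n); rewrite /B opAB /cdot.
  set u := _ - _; rewrite -(scaled_dot u.2).
  rewrite (_ : Rintegral _ _ _ = dot (scaled u.2) (scaled u.2)).
    by rewrite lerDr wdot_ge0.
  apply: eq_Rintegral => p _; rewrite /w2 /scaled.
  rewrite -[u.2]/((opA (phi n.+1)).2 - (opA (phi n)).2) testD testN; ring.
have [P [sP normP dotP]] := fast_L2_cvg sw1 step1.
have [Q [sQ normQ dotQ]] := fast_L2_cvg sw2 step2.
have eta_cvg : (4^-1 : R) ^+ n @[n --> \oo] --> (0 : R).
  by apply: cvg_expr; rewrite gtr0_norm// invf_lt1// ltr1n.
exists P, Q; split=> // [|u].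
  have sumC : (fun n => Rintegral mu setT (fun p => w1 n p ^+ 2)
      + Rintegral mu setT (fun p => w2 n p ^+ 2)) @ \oo --> dot P P + dot Q Q.
    exact: cvgD normP normQ.
  have boundC : (fun n => (C + 4^-1 ^+ n) ^+ 2) @ \oo --> (C + 0) ^+ 2.
    rewrite (_ : (fun n => _) = fun n => (C + 4^-1 ^+ n) * (C + 4^-1 ^+ n)) ?expr2//.
    by apply: cvgM; apply: cvgD => //; exact: cvg_cst.
  rewrite -C2 -[C]addr0; apply: (ler_cvg_to sumC boundC); apply: nearW => n.
  have [_ _ h] := phiP n; apply: le_trans h; rewrite /B /cdot -!scaled_dot.
  by [].
have lim1 : B (phi n) u @[n --> \oo] --> functional u.
  apply/cvgrPdist_le => e e0.
  (* When [B u u = 0] the Euler estimate is already an equality; otherwise the tolerance is divided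
     by the norm of [u]. *)
  have [q0|qn0] := eqVneq (B u u) 0.
    apply: nearW => n; have [_ h _] := phiP n; have := h u.
    rewrite q0 mulr0 => /(conj (sqr_ge0 _))/andP/le_anti/esym/eqP.
    by rewrite sqrf_eq0 distrC => /eqP ->; rewrite normr0 ltW.
  have q0 : 0 < B u u by rewrite lt_neqAle eq_sym qn0 B0.
  have s0 : 0 < Num.sqrt (B u u) by rewrite sqrtr_gt0.
  have /cvgrPdist_le /(_ _ (divr_gt0 e0 s0)) := eta_cvg.
  apply: filterS => n; rewrite sub0r normrN (gtr0_norm (eta0 n)) ler_pdivlMr// => hn.
  have [_ h _] := phiP n; apply: le_trans hn; rewrite distrC.
  rewrite -(@ler_pXn2r _ 2)// ?nnegrE ?mulr_ge0 ?(ltW (eta0 n)) ?(ltW s0)//.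
  by rewrite real_normK ?num_real// exprMn sqr_sqrtr.
have lim2 : B (phi n) u @[n --> \oo] -->
    dot P (scaled (opA u).1) + dot Q (scaled (opA u).2).
  rewrite (_ : (fun n => _) = fun n =>
    Rintegral mu setT (fun p => w1 n p * scaled (opA u).1 p)
    + Rintegral mu setT (fun p => w2 n p * scaled (opA u).2 p)).
    by apply: cvgD; [apply: dotP|apply: dotQ]; exact: scaled_sq_integrable.
  by apply/funext => n; rewrite /B /cdot -!scaled_dot.
exact: (cvg_unique _ lim2 lim1).
Qed.

End real_solution.

(** * Translation to complex-valued functions *)

Section complex_parts.
Variable R : realType.
Implicit Types z w : R[i].

Lemma ReD z w : complex.Re (z + w) = complex.Re z + complex.Re w.
Proof. by case: z w => [a b] [c d]. Qed.
Lemma ImD z w : complex.Im (z + w) = complex.Im z + complex.Im w.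
Proof. by case: z w => [a b] [c d]. Qed.
Lemma ReN z : complex.Re (- z) = - complex.Re z.
Proof. by case: z. Qed.
Lemma ImN z : complex.Im (- z) = - complex.Im z.
Proof. by case: z. Qed.
Lemma ReM z w : complex.Re (z * w) =
  complex.Re z * complex.Re w - complex.Im z * complex.Im w.
Proof. by case: z w => [a b] [c d]. Qed.
Lemma ImM z w : complex.Im (z * w) =
  complex.Re z * complex.Im w + complex.Im z * complex.Re w.
Proof. by case: z w => [a b] [c d]. Qed.
Lemma ReC (x : R) : complex.Re x%:C = x. Proof. by []. Qed.
Lemma ImC (x : R) : complex.Im x%:C = 0. Proof. by []. Qed.
Lemma half_complex : (2^-1 : R[i]) = (2^-1)%:C.
Proof. by rewrite fmorphV rmorph_nat. Qed.
End complex_parts.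

Definition ReImE := (ReD, ImD, ReN, ImN, ReM, ImM, half_complex).

(** * The Gaussian space and plain L2 *)

Section gauss_space.
Variable R : realType.
Local Notation mu := (plane_measure R).
Local Notation dot := (L2dot mu).
Implicit Types g u : R[i] -> R[i].

Lemma sqr_modulus (z : R[i]) :
  modulus z ^+ 2 = complex.Re z ^+ 2 + complex.Im z ^+ 2.
Proof.
by rewrite /modulus; case: z => a b /=; rewrite sqr_sqrtr// addr_ge0 ?sqr_ge0.
Qed.

Definition descaled (g : R * R -> R) (p : R * R) : R := g p / half_weight p.

Lemma gauss_density g p :
  modulus (g (toC p)) ^+ 2 * expR (- modulus (toC p) ^+ 2) =
  descaled (rpart g) p ^+ 2 + descaled (ipart g) p ^+ 2.
Proof.
rewrite !sqr_modulus /= expRN -[expR _]/(weight p) -sqr_half_weight.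
by rewrite /descaled !expr_div_n mulrDl.
Qed.

Lemma descaled_measurable (g : R * R -> R) :
  measurable_fun setT g -> measurable_fun setT (descaled g).
Proof.
move=> mg; apply: measurable_funM => //; apply: continuous_plane_measurable => p.
by apply: cvgV; [rewrite gt_eqF// half_weight_gt0|exact: continuous_half_weight].
Qed.

Lemma L2gauss_descaled g : L2gauss g -> [/\ sq_integrable mu (descaled (rpart g)),
  sq_integrable mu (descaled (ipart g)) &
  gauss_sqnorm g = (dot (descaled (rpart g)) (descaled (rpart g))
    + dot (descaled (ipart g)) (descaled (ipart g)))%:E].
Proof.
move=> [[[mr mi] _] gfin].
have m1 := descaled_measurable mr; have m2 := descaled_measurable mi.
have E : gauss_sqnorm g = (\int[mu]_p ((descaled (rpart g) p ^+ 2)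
    + descaled (ipart g) p ^+ 2)%:E)%E.
  by apply: eq_integral => p _; rewrite gauss_density.
have i12 : mu.-integrable setT (fun p => (descaled (rpart g) p ^+ 2
    + descaled (ipart g) p ^+ 2)%:E).
  apply/integrableP; split.
    by apply/measurable_EFinP; apply: measurable_funD; exact: measurable_funX.
  under eq_integral do rewrite gee0_abs ?lee_fin ?addr_ge0 ?sqr_ge0//.
  by rewrite -E.
have s1 : sq_integrable mu (descaled (rpart g)).
  split=> //; apply: (le_integrable measurableT _ _ i12).
    by apply/measurable_EFinP; exact: measurable_funX.
  move=> p _; rewrite !abse_EFin lee_fin !ger0_norm ?addr_ge0 ?sqr_ge0//.
  by rewrite lerDl sqr_ge0.
have s2 : sq_integrable mu (descaled (ipart g)).
  split=> //; apply: (le_integrable measurableT _ _ i12).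
    by apply/measurable_EFinP; exact: measurable_funX.
  move=> p _; rewrite !abse_EFin lee_fin !ger0_norm ?addr_ge0 ?sqr_ge0//.
  by rewrite lerDr sqr_ge0.
split=> //; rewrite E /L2dot -RintegralD//; last 2 first.
- by case: s1.
- by case: s2.
by rewrite /Rintegral fineK//; exact: integrable_fin_num.
Qed.

(* [exp (|z|^2 / 2)] times the conjugate of [P + i Q]: the conjugate turns the
   real inner product into the real part of the bilinear pairing. *)
Definition of_parts (P Q : R * R -> R) (z : R[i]) : R[i] :=
  let p := (complex.Re z, complex.Im z) in
  (half_weight p * P p) +i* (half_weight p * - Q p).

Lemma rpart_of_parts P Q : rpart (of_parts P Q) = fun p => half_weight p * P p.
Proof. by apply/funext => -[x y]. Qed.

Lemma ipart_of_parts P Q : ipart (of_parts P Q) = fun p => half_weight p * - Q p.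
Proof. by apply/funext => -[x y]. Qed.

Lemma L2gauss_of_parts P Q : sq_integrable mu P -> sq_integrable mu Q ->
  L2gauss (of_parts P Q) /\ gauss_sqnorm (of_parts P Q) = (dot P P + dot Q Q)%:E.
Proof.
move=> [mP iP] [mQ iQ].
have mh : measurable_fun setT (@half_weight R).
  exact: (continuous_plane_measurable (@continuous_half_weight R)).
have E : gauss_sqnorm (of_parts P Q) = (dot P P + dot Q Q)%:E.
  rewrite /L2dot -RintegralD// /Rintegral fineK.
    apply: eq_integral => p _; rewrite gauss_density rpart_of_parts ipart_of_parts.
    rewrite /descaled; congr (_%:E).
    by field; rewrite gt_eqF// half_weight_gt0.
  apply: integrable_fin_num => //; exact: (integrableD measurableT iP iQ).
split=> //; split; last by rewrite E ltry.
have mu1 : measurable_fun setT (rpart (of_parts P Q)).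
  by rewrite rpart_of_parts; exact: measurable_funM.
have mu2 : measurable_fun setT (ipart (of_parts P Q)).
  by rewrite ipart_of_parts; apply: measurable_funM => //; exact: measurableT_comp.
split; first by [].
move=> K cK; have mK := compact_plane_measurable cK.
have cw : {within K, continuous (@weight R)}.
  exact: (continuous_subspaceT (@continuous_weight R)).
(* Local square integrability follows because the weight is bounded on the compact set. *)
have [M [_ wM]] := compact_bounded (continuous_compact cw cK).
have {}wM p : K p -> weight p <= M + 1.
  move=> Kp; apply: le_trans (ler_norm _) _; apply: (wM (M + 1)); last by exists p.
  by rewrite ltrDl.
have i1 : mu.-integrable K (fun p => (M + 1)%:E * ((P p ^+ 2)%:E + (Q p ^+ 2)%:E))%E.
  apply: (integrableS measurableT) => //; apply: integrableZl => //.
  exact: integrableD.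
have i2 : mu.-integrable K (fun p => (modulus (of_parts P Q (toC p)) ^+ 2)%:E).
  apply: (le_integrable _ _ _ i1) => //.
    apply: measurable_funTS; apply/measurable_EFinP.
    rewrite (_ : (fun p => _) = fun p => rpart (of_parts P Q) p ^+ 2
        + ipart (of_parts P Q) p ^+ 2); last first.
      by apply/funext => p; rewrite sqr_modulus.
    by apply: measurable_funD; exact: measurable_funX.
  move=> [x y] Kp; rewrite -EFinD -EFinM !abse_EFin lee_fin.
  rewrite [leLHS]ger0_norm ?sqr_ge0//; apply: le_trans _ (ler_norm _).
  rewrite sqr_modulus /= !exprMn sqr_half_weight sqrrN -mulrDr.
  by rewrite ler_wpM2r ?addr_ge0 ?sqr_ge0// wM.
have /integrableP[_] := i2; apply: le_lt_trans.
by under [leRHS]eq_integral do rewrite gee0_abs ?lee_fin ?sqr_ge0//.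
Qed.

End gauss_space.

(** * Complex test functions as pairs *)

Section complex_translation.
Variable R : realType.
Local Notation mu := (plane_measure R).
Local Notation V := (test R * test R)%type.
Local Notation dot := (L2dot mu).

Definition represents (g : R[i] -> R[i]) (u : V) : Prop :=
  rpart g = u.1 /\ ipart g = u.2.

Lemma represents_wirtinger g u : represents g u -> represents (wirtinger g) (Dz u).
Proof.
move=> [g1 g2]; split; apply/funext => -[x y].
  transitivity (complex.Re (wirtinger g (toC (x, y)))) => //.
  rewrite /wirtinger /partial_along g1 g2 !ReImE.
  rewrite -[(Dz u).1]/(2^-1 *: (dx u.1 + dy u.2)).
  by rewrite !ptE !dxE !dyE /=; ring.
transitivity (complex.Im (wirtinger g (toC (x, y)))) => //.
rewrite /wirtinger /partial_along g1 g2 !ReImE.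
rewrite -[(Dz u).2]/(2^-1 *: (dx u.2 - dy u.1)).
by rewrite !ptE !dxE !dyE /=; ring.
Qed.

Lemma represents_wirtinger_bar g u :
  represents g u -> represents (wirtinger_bar g) (Dzb u).
Proof.
move=> [g1 g2]; split; apply/funext => -[x y].
  transitivity (complex.Re (wirtinger_bar g (toC (x, y)))) => //.
  rewrite /wirtinger_bar /partial_along g1 g2 !ReImE.
  rewrite -[(Dzb u).1]/(2^-1 *: (dx u.1 - dy u.2)).
  by rewrite !ptE !dxE !dyE /=; ring.
transitivity (complex.Im (wirtinger_bar g (toC (x, y)))) => //.
rewrite /wirtinger_bar /partial_along g1 g2 !ReImE.
rewrite -[(Dzb u).2]/(2^-1 *: (dx u.2 + dy u.1)).
by rewrite !ptE !dxE !dyE /=; ring.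
Qed.

Lemma represents_iter k g u : represents g u -> represents
  (iter k (@wirtinger R) (iter k (@wirtinger_bar R) g))
  (iter k (@Dz R) (iter k (@Dzb R) u)).
Proof.
move=> gu; have : represents (iter k (@wirtinger_bar R) g) (iter k (@Dzb R) u).
  by elim: k => // k IH; exact: represents_wirtinger_bar.
move: (iter k _ g) (iter k _ u) => h v hv.
by elim: k => // k IH; exact: represents_wirtinger.
Qed.

Lemma test_representation phi : csmooth phi -> compactly_supported phi ->
  exists u, represents phi u.
Proof.
move=> sphi cphi; have [M [_ MP]] := compact_bounded cphi.
have out p : M + 1 < `|p| -> phi (toC p) = 0.
  move=> Mp; apply/eqP; apply: contraLR Mp => phip; rewrite -leNgt.
  by apply: (MP (M + 1)); [rewrite ltrDl|exact: subset_closure].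
have t1 : test_fun (rpart phi).
  split=> [n|]; first by case: (sphi n).
  by exists (M + 1) => p /out; rewrite /rpart => ->.
have t2 : test_fun (ipart phi).
  split=> [n|]; first by case: (sphi n).
  by exists (M + 1) => p /out; rewrite /ipart => ->.
by exists (mk_test t1, mk_test t2).
Qed.

Lemma Dz_cmul c1 c2 (u : V) : Dz (cmul c1 c2 u) = cmul c1 c2 (Dz u).
Proof.
by apply: injective_projections => /=; rewrite !opE;
  apply: test_ext => p; rewrite !ptE; field.
Qed.

Lemma Dzb_cmul c1 c2 (u : V) : Dzb (cmul c1 c2 u) = cmul c1 c2 (Dzb u).
Proof.
by apply: injective_projections => /=; rewrite !opE;
  apply: test_ext => p; rewrite !ptE; field.
Qed.

(** Complex linearity of the operator, through which the real identity also yields the imaginary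
    part. *)
Lemma opA_cmul k c1 c2 d1 d2 (u : V) :
  opA k c1 c2 (cmul d1 d2 u) = cmul d1 d2 (opA k c1 c2 u).
Proof.
rewrite /opA linearD; congr (_ + _).
  have iterC (g : V -> V) n v : (forall v, g (cmul d1 d2 v) = cmul d1 d2 (g v)) ->
      iter n g (cmul d1 d2 v) = cmul d1 d2 (iter n g v).
    by move=> gC; elim: n => // n IH; rewrite !iterS IH gC.
  by rewrite (iterC (@Dzb R) k u (Dzb_cmul d1 d2)) (iterC _ _ _ (Dz_cmul d1 d2)).
by apply: injective_projections => /=; apply: test_ext => p; rewrite !ptE; ring.
Qed.

Lemma Rintegral_mul_test (P : R * R -> R) (u : test R) : sq_integrable mu P ->
  mu.-integrable setT (fun p => (half_weight p * P p * u p)%:E).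
Proof.
move=> sP; apply: eq_integrable (sq_integrable_mul sP (scaled_sq_integrable u)) => //.
by move=> p _; rewrite /scaled; congr (_%:E); ring.
Qed.

Lemma dot_scaled (P : R * R -> R) (u : test R) :
  dot P (scaled u) = Rintegral mu setT (fun p => half_weight p * P p * u p).
Proof. by apply: eq_Rintegral => p _; rewrite /scaled; ring. Qed.

Lemma cintegral_eq (g h : R[i] -> R[i]) :
  Rintegral mu setT (rpart g) = Rintegral mu setT (rpart h) ->
  Rintegral mu setT (ipart g) = Rintegral mu setT (ipart h) ->
  cintegral g = cintegral h.
Proof. by rewrite /cintegral => -> ->. Qed.

Lemma Rintegral_comb (alpha : R) (P Q : R * R -> R) (u v : test R) :
    sq_integrable mu P -> sq_integrable mu Q ->
  Rintegral mu setT (fun p => alpha *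
    (half_weight p * P p * u p + half_weight p * Q p * v p)) =
  alpha * (dot P (scaled u) + dot Q (scaled v)).
Proof.
move=> sP sQ; rewrite !dot_scaled.
have iP := Rintegral_mul_test u sP; have iQ := Rintegral_mul_test v sQ.
by rewrite RintegralZl ?RintegralD//; exact: (integrableD measurableT iP iQ).
Qed.

End complex_translation.

Theorem theorem4p6 (R : realType) (k : nat) (hk : (1 <= k)%N) (c : R[i])
    (alpha : R) (halpha : 1 <= `|alpha|)
    (f : R[i] -> R[i]) (hf : L2gauss f) :
  exists u : R[i] -> R[i],
    [/\ L2gauss u,
        weak_solution alpha k c (fun z => alpha%:C * f z) u &
        (gauss_sqnorm u <=
          (`|alpha| ^+ 2 / (k`!%:R) ^+ 2)%:E * gauss_sqnorm f)%E].
Proof.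
have a0 : alpha != 0 by rewrite -normr_gt0 (lt_le_trans _ halpha).
have [s1 s2 fE] := L2gauss_descaled hf.
set F1 := descaled _ in s1 fE; set F2 := descaled _ in s2 fE.
(* The operator is [alpha] times the one with constant [c / alpha], and the right-hand side carries
   the same factor. *)
pose c1 := complex.Re c / alpha; pose c2 := complex.Im c / alpha.
have [P [Q [sP sQ PQ sol]]] := exists_real_solution c1 c2 hk s1 s2.
have [L2u uE] := L2gauss_of_parts sP sQ.
have sN G : sq_integrable (plane_measure R) G ->
    sq_integrable (plane_measure R) (fun p => - G p).
  move=> [mG iG]; split; first exact: measurableT_comp.
  by under eq_fun do rewrite sqrrN.
exists (of_parts P Q); split=> //; last first.
  (* The solution satisfies the bound with 1 in place of [|alpha|^2], and [|alpha| >= 1] weakens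
     it. *)
  rewrite uE fE -EFinM lee_fin; apply: le_trans PQ _; rewrite mulrC.
  set N := L2dot _ _ _ + _.
  rewrite ler_wpM2r ?addr_ge0 ?L2dot_ge0// -[leLHS]mul1r ler_wpM2r ?invr_ge0 ?sqr_ge0//.
  by rewrite exprn_ege1.
split; first by case: L2u.
move=> phi sphi cphi; have [u [phi1 phi2]] := test_representation sphi cphi.
have [D1 D2] := represents_iter k (conj phi1 phi2).
pose v := opA k c1 c2 u.
have A1 p : v.1 p =
    (iter k (@Dz R) (iter k (@Dzb R) u)).1 p + (c1 * u.1 p - c2 * u.2 p).
  by rewrite -[v.1]/((iter k _ _).1 + (c1 *: u.1 - c2 *: u.2)) !ptE.
have A2 p : v.2 p =
    (iter k (@Dz R) (iter k (@Dzb R) u)).2 p + (c1 * u.2 p + c2 * u.1 p).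
  by rewrite -[v.2]/((iter k _ _).2 + (c1 *: u.2 + c2 *: u.1)) !ptE.
have ca1 : complex.Re c = alpha * c1 by rewrite /c1 mulrC divfK.
have ca2 : complex.Im c = alpha * c2 by rewrite /c2 mulrC divfK.
have half0 p : half_weight p != 0 :> R by rewrite gt_eqF// half_weight_gt0.
have f1E p : complex.Re (f (toC p)) = half_weight p * F1 p.
  by rewrite /F1 /descaled mulrC divfK.
have f2E p : complex.Im (f (toC p)) = half_weight p * F2 p.
  by rewrite /F2 /descaled mulrC divfK.
have p1E p : complex.Re (phi (toC p)) = u.1 p by rewrite -phi1.
have p2E p : complex.Im (phi (toC p)) = u.2 p by rewrite -phi2.
have d1E p : complex.Re (iter k (@wirtinger R) (iter k (@wirtinger_bar R) phi) (toC p))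
    = (iter k (@Dz R) (iter k (@Dzb R) u)).1 p by rewrite -D1.
have d2E p : complex.Im (iter k (@wirtinger R) (iter k (@wirtinger_bar R) phi) (toC p))
    = (iter k (@Dz R) (iter k (@Dzb R) u)).2 p by rewrite -D2.
(* [cmul 0 (-1)] is multiplication by [- i], and the real part of [- i z] is the imaginary part of
   [z]. *)
have sol' := sol (cmul 0 (-1) u); rewrite opA_cmul in sol'.
have u1E p : complex.Re (of_parts P Q (toC p)) = half_weight p * P p by case: p.
have u2E p : complex.Im (of_parts P Q (toC p)) = - (half_weight p * Q p).
  by case: p => x y /=; rewrite mulrN.
apply: cintegral_eq.
- transitivity (alpha * (L2dot (plane_measure R) P (scaled v.1)
      + L2dot (plane_measure R) Q (scaled v.2))).
    rewrite -Rintegral_comb//; apply: eq_Rintegral => p _.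
    rewrite /rpart !ReImE (ReC alpha) (ImC alpha).
    rewrite u1E u2E p1E p2E d1E d2E ca1 ca2 A1 A2; ring.
  rewrite sol /functional -[- L2dot _ _ _]mulN1r.
  (* The minus sign in the real part of a product is absorbed into [F2], which gives the shape of
     [Rintegral_comb]. *)
  transitivity (alpha * (L2dot (plane_measure R) F1 (scaled u.1)
      + L2dot (plane_measure R) (fun p => - F2 p) (scaled u.2))).
    congr (_ * (_ + _)); rewrite !dot_scaled -RintegralZl//; last first.
      exact: Rintegral_mul_test.
    by apply: eq_Rintegral => p _; ring.
  rewrite -Rintegral_comb//; last exact: sN.
  apply: eq_Rintegral => p _; rewrite /rpart !ReImE (ReC alpha) (ImC alpha).
  rewrite f1E f2E p1E p2E; ring.
- pose w := cmul 0 (-1) v; pose u' := cmul 0 (-1) u.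
  have w1 p : w.1 p = v.2 p by rewrite -[w.1]/(0 *: v.1 - (-1) *: v.2) !ptE; ring.
  have w2 p : w.2 p = - v.1 p by rewrite -[w.2]/(0 *: v.2 + (-1) *: v.1) !ptE; ring.
  have u'1 p : u'.1 p = u.2 p by rewrite -[u'.1]/(0 *: u.1 - (-1) *: u.2) !ptE; ring.
  have u'2 p : u'.2 p = - u.1 p by rewrite -[u'.2]/(0 *: u.2 + (-1) *: u.1) !ptE; ring.
  transitivity (alpha * (L2dot (plane_measure R) P (scaled w.1)
      + L2dot (plane_measure R) Q (scaled w.2))).
    rewrite -Rintegral_comb//; apply: eq_Rintegral => p _.
    rewrite /ipart !ReImE (ReC alpha) (ImC alpha).
    rewrite u1E u2E p1E p2E d1E d2E ca1 ca2 w1 w2 A1 A2; ring.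
  rewrite sol' /functional -[- L2dot _ _ _]mulN1r.
  transitivity (alpha * (L2dot (plane_measure R) F1 (scaled u'.1)
      + L2dot (plane_measure R) (fun p => - F2 p) (scaled u'.2))).
    congr (_ * (_ + _)); rewrite !dot_scaled -RintegralZl//; last first.
      exact: Rintegral_mul_test.
    by apply: eq_Rintegral => p _; ring.
  rewrite -Rintegral_comb//; last exact: sN.
  apply: eq_Rintegral => p _; rewrite /ipart !ReImE (ReC alpha) (ImC alpha).
  rewrite f1E f2E p1E p2E u'1 u'2; ring.
Qed.
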